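(* Let $k\geq 8$ be an integer and let $C_4(k)^*$ denote the (combinatorial) dual of the $4$-dimensional cyclic polytope $C_4(k)$ with $k$ vertices. No realization of $C_4(k)^*$ has an inscribed facet, although every facet of $C_4(k)^*$ is inscribable.
   Context: The cyclic polytope $C_d(k)$ is the combinatorial type of the convex hull of $k$ distinct points on the moment curve $t\mapsto (t,t^2,\dots,t^d)$ in $\mathbb{R}^d$; $C_d(k)^*$ is its dual, i.e. the combinatorial type whose face lattice is the face lattice of $C_d(k)$ with reversed order. A realization of a combinatorial type of polytope is a convex polytope (in Euclidean space, of the same dimension) whose face lattice is isomorphic to the given one. A polytope (or a face of a polytope, regarded as a polytope in its affine hull) is inscribed if all its vertices lie on a common sphere (in its affine hull). A polytope is inscribable if it is combinatorially equivalent to an inscribed polytope. *)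

(* Defs.v *)
From HB Require Import structures.
From mathcomp Require Import all_boot all_order all_algebra.
From mathcomp Require Import boolp classical_sets functions cardinality reals.

Set Implicit Arguments.
Unset Strict Implicit.
Unset Printing Implicit Defensive.

Import Order.TTheory GRing.Theory Num.Theory.

Local Open Scope classical_set_scope.
Local Open Scope ring_scope.

Section Euclidean.
Context {R : realType} {n : nat}.
Implicit Types (x y a c v : 'rV[R]_n) (A : set 'rV[R]_n).

Definition dot x y : R := \sum_(i < n) x 0 i * y 0 i.

(* The norm that MathComp-Analysis puts on row vectors is the sup norm, so the
   Euclidean one is spelled out. *)
Definition enorm x : R := Num.sqrt (dot x x).

Definition sphere c (r : R) : set 'rV[R]_n := [set x | enorm (x - c) = r].

Definition convex_hull A : set 'rV[R]_n :=
  [set x | exists (m : nat) (p : 'I_m -> 'rV[R]_n) (w : 'I_m -> R),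
     [/\ forall i, A (p i), forall i, 0 <= w i, \sum_(i < m) w i = 1
       & x = \sum_(i < m) w i *: p i]].

Definition affine_hull A : set 'rV[R]_n :=
  [set x | exists (m : nat) (p : 'I_m -> 'rV[R]_n) (w : 'I_m -> R),
     [/\ forall i, A (p i), \sum_(i < m) w i = 1
       & x = \sum_(i < m) w i *: p i]].

(* The empty set has no dimension in this sense (rather than dimension -1). *)
Definition has_dim A (d : nat) : Prop :=
  exists (x : 'rV[R]_n) (U : {vspace 'rV[R]_n}),
    affine_hull A = [set x + u | u in [set u | u \in U]] /\ \dim U = d.

End Euclidean.

Section Polytopes.
Context {R : realType} {n : nat}.
Implicit Types (P F : set 'rV[R]_n) (v : 'rV[R]_n).

Definition polytope P : Prop :=
  exists2 V : set 'rV[R]_n, finite_set V & P = convex_hull V.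

(* Taking a = 0 makes P itself (b = 0) and the empty set (b = 1) faces of P. *)
Definition face P F : Prop :=
  exists (a : 'rV[R]_n) (b : R),
    (forall x, P x -> dot a x <= b) /\ F = P `&` [set x | dot a x = b].

Definition vertex P v : Prop := face P [set v].

Definition facet P F : Prop :=
  face P F /\ exists d : nat, has_dim P d.+1 /\ has_dim F d.

(* A sphere of the affine hull is a sphere centred at a point of that hull. *)
Definition inscribed P : Prop :=
  exists (c : 'rV[R]_n) (r : R),
    affine_hull P c /\ (forall v, vertex P v -> sphere c r v).

End Polytopes.

Section Combinatorics.
Context {R : realType}.

Definition comb_equiv {m n : nat} (P : set 'rV[R]_m) (Q : set 'rV[R]_n) : Prop :=
  exists2 f : set 'rV[R]_m -> set 'rV[R]_n,
    set_bij (face P) (face Q) f &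
    forall F G, face P F -> face P G -> (F `<=` G <-> f F `<=` f G).

Definition comb_dual {m n : nat} (P : set 'rV[R]_m) (Q : set 'rV[R]_n) : Prop :=
  exists2 f : set 'rV[R]_m -> set 'rV[R]_n,
    set_bij (face P) (face Q) f &
    forall F G, face P F -> face P G -> (F `<=` G <-> f G `<=` f F).

Definition inscribable {n : nat} (P : set 'rV[R]_n) : Prop :=
  exists (m : nat) (Q : set 'rV[R]_m),
    [/\ polytope Q, comb_equiv P Q & inscribed Q].

Definition moment_curve (d : nat) (t : R) : 'rV[R]_d :=
  \row_(i < d) t ^+ i.+1.

Definition cyclic_polytope (d k : nat) (t : 'I_k -> R) : set 'rV[R]_d :=
  convex_hull (range (fun i => moment_curve d (t i))).

Arguments cyclic_polytope d {k} t.

(* P realizes C_d(k)^*.  The combinatorial type of the cyclic polytope does not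
   depend on the parameters t; any choice of them is accepted here. *)
Definition realizes_dual_cyclic (d k : nat) {n : nat} (P : set 'rV[R]_n) : Prop :=
  [/\ polytope P, has_dim P d &
      exists2 t : 'I_k -> R, injective t & comb_dual P (cyclic_polytope d t)].

End Combinatorics.

(* Main.v *)
Require Import Defs.
From mathcomp Require Import all_boot all_order all_algebra.
From mathcomp Require Import boolp classical_sets functions cardinality reals.
From mathcomp Require Import ring lra zify.

(* A facet F of a realization P of C_4(k)^* is dual to a vertex of C_4(k), so it
   is combinatorially a wedge: two (k-2)-gons sharing an edge xy, whose other
   vertices a_i, b_i are joined by edges; consecutive edges a_i b_i span the
   remaining facets.

   Suppose F is inscribed. The a_i and the b_i lie on two circles through x and
   y; parametrize each circle by the ratio t_i, resp. s_i, of the distances to x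
   and y. A chord t t' meets the line xy at a point depending only on t t', so
   planarity of the quadrilaterals gives t_i t_(i+1) = s_i s_(i+1), and
   t_i / s_i alternates between two values. On the other hand the vertices
   {1,2,3,4} and {2,3,4,5} of P, which are not on F, force three consecutive
   points (1 / t_i, 1 / s_i) to be always oriented the same way. For k >= 8 there
   are four such points, and these two facts contradict each other.

   A wedge over two half-circles in planes that are symmetric about the line xy,
   with t_i = s_i, is inscribed and has the same faces as F. *)

Set Implicit Arguments.
Unset Strict Implicit.
Unset Printing Implicit Defensive.

Import Order.TTheory GRing.Theory Num.Theory.

Local Open Scope classical_set_scope.
Local Open Scope ring_scope.

(** * Faces of polytopes *)

Section Slack.
Context {R : realType} {n : nat}.
Implicit Types (x y v : 'rV[R]_n) (h : 'rV[R]_n * R) (V P F G : set 'rV[R]_n).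

(** F by itself carries no obstruction, so the contradiction must use vertices off F. The line
    through the vertices {1,2,3,4} and {2,3,4,5} lies in the hyperplanes of the facets 2, 3, 4; the
    point where it meets the hyperplane of F therefore lies on those three facet planes, and its
    slacks for the facets 1 and 5 have opposite signs. This point is kept in homogeneous form, so
    the line may also be parallel to that hyperplane. On an inscribed F, subtracting the suitably
    scaled slacks of this point for the facets i and i + 1 isolates A + C / t_i + D / s_i with fixed
    A, C, D. This is positive for i = 1, zero for i = 2 and 3, positive for i = 4. After
    multiplication by t_i it becomes A t_i plus a term depending only on the parity of i. Since the
    t_i increase, comparing 1 with 3 gives A < 0, and comparing 2 with 4 gives A > 0. *)

Lemma dotDl x y v : dot (x + y) v = dot x v + dot y v.
Proof. by rewrite -big_split; apply: eq_bigr => i _; rewrite mxE mulrDl. Qed.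

Lemma dotZl (c : R) x v : dot (c *: x) v = c * dot x v.
Proof. by rewrite mulr_sumr; apply: eq_bigr => i _; rewrite mxE mulrA. Qed.

Lemma dotC x y : dot x y = dot y x.
Proof. by apply: eq_bigr => i _; rewrite mulrC. Qed.

Lemma dotDr x y v : dot v (x + y) = dot v x + dot v y.
Proof. by rewrite !(dotC v) dotDl. Qed.

Lemma dotZr (c : R) x v : dot v (c *: x) = c * dot v x.
Proof. by rewrite !(dotC v) dotZl. Qed.

Lemma dotNl x v : dot (- x) v = - dot x v.
Proof. by rewrite -scaleN1r dotZl mulN1r. Qed.

Lemma dotNr x v : dot v (- x) = - dot v x.
Proof. by rewrite !(dotC v) dotNl. Qed.

Lemma dotBl x y v : dot (x - y) v = dot x v - dot y v.
Proof. by rewrite dotDl dotNl. Qed.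

Lemma dotBr x y v : dot v (x - y) = dot v x - dot v y.
Proof. by rewrite dotDr dotNr. Qed.

Lemma dot0r v : dot v 0 = 0.
Proof. by rewrite -[0](subrr 0) dotBr subrr. Qed.

Lemma dot_sumr m (p : 'I_m -> 'rV[R]_n) v :
  dot v (\sum_i p i) = \sum_i dot v (p i).
Proof.
apply: (big_ind2 (fun a b => dot v a = b)) => //; first exact: dot0r.
by move=> ? ? ? ? <- <-; rewrite dotDr.
Qed.

Lemma dot_ge0 x : 0 <= dot x x.
Proof. by apply: sumr_ge0 => i _; rewrite -expr2 sqr_ge0. Qed.

Lemma dot_eq0 x : (dot x x == 0) = (x == 0).
Proof.
apply/idP/eqP => [|->]; last by rewrite dot0r.
rewrite psumr_eq0 => [/allP xx0|i _]; last by rewrite -expr2 sqr_ge0.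
apply/rowP => i; rewrite mxE; apply/eqP.
by have := xx0 i (mem_index_enum _); rewrite mulf_eq0 orbb.
Qed.

(** Pairing normal and bound makes inequalities vectors, so that they can be added and scaled. *)
Definition slack h x : R := h.2 - dot h.1 x.

Lemma slackD h h' x : slack (h + h') x = slack h x + slack h' x.
Proof. by rewrite /slack dotDl /=; ring. Qed.

Lemma slackZ c h x : slack (c *: h.1, c * h.2) x = c * slack h x.
Proof. by rewrite /slack /= dotZl; ring. Qed.

Lemma slack_sum h m (p : 'I_m -> 'rV[R]_n) (w : 'I_m -> R) :
  \sum_i w i = 1 -> slack h (\sum_i w i *: p i) = \sum_i w i * slack h (p i).
Proof.
move=> w1; rewrite /slack dot_sumr.
transitivity ((\sum_i w i) * h.2 - \sum_i dot h.1 (w i *: p i)).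
  by rewrite w1 mul1r.
rewrite mulr_suml -sumrB; apply: eq_bigr => i _.
by rewrite dotZr mulrBr.
Qed.

Definition zeros P h := [set x | P x /\ slack h x = 0].

Lemma faceP P F :
  face P F <-> exists2 h, (forall x, P x -> 0 <= slack h x) & F = zeros P h.
Proof.
split=> [[a [b [ab ->]]]|[[a b] ab ->]].
  exists (a, b) => [x Px|]; first by rewrite subr_ge0 ab.
  by apply/seteqP; split=> x [Px]; rewrite /zeros /slack /= => abx; split=> //; lra.
exists a, b; split=> [x Px|]; first by rewrite -subr_ge0 (ab x Px).
by apply/seteqP; split=> x [Px]; rewrite /zeros /slack /= => abx; split=> //; lra.
Qed.

Lemma face_sub P F : face P F -> F `<=` P.
Proof. by case/faceP=> h _ -> x []. Qed.

Lemma face_self P : face P P.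
Proof.
apply/faceP; exists 0 => [x _|]; first by rewrite /slack dotC dot0r subr0.
by apply/seteqP; split=> [x Px|x []//]; split=> //; rewrite /slack dotC dot0r subr0.
Qed.

Lemma face_set0 P : face P set0.
Proof.
apply/faceP; exists (0, 1) => [x _|].
  by rewrite /slack dotC dot0r subr0 ler01.
apply/seteqP; split=> x // [_]; rewrite /slack dotC dot0r subr0 => /eqP.
by rewrite oner_eq0.
Qed.

Lemma face_of_face P F G : face P F -> face P G -> G `<=` F -> face F G.
Proof.
move=> /face_sub FP /faceP[h h0 eG] GF; apply/faceP; exists h => [x /FP/h0//|].
apply/seteqP; split=> x; first by move=> Gx; split; [exact: GF|move: Gx;
  rewrite eG => -[]].
by case=> Fx hx; rewrite eG; split=> //; exact: FP.
Qed.

Lemma sub_convex_hull V : V `<=` convex_hull V.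
Proof.
move=> x Vx; exists 1%N, (fun=> x), (fun=> 1).
by split=> //; rewrite big_ord_recl big_ord0 addr0 ?scale1r.
Qed.

Lemma slack_hull_ge0 V h :
  (forall v, V v -> 0 <= slack h v) ->
  forall x, convex_hull V x -> 0 <= slack h x.
Proof.
move=> hV x [m [p [w [Vp w0 w1 ->]]]]; rewrite slack_sum //.
by apply: sumr_ge0 => i _; rewrite mulr_ge0 ?hV.
Qed.

(* A convex combination of points of V lies on a supporting hyperplane only if
   every point of positive weight does. *)
Lemma zeros_hull V h : (forall v, V v -> 0 <= slack h v) ->
  zeros (convex_hull V) h = convex_hull (zeros V h).
Proof.
move=> hV; apply/seteqP; split=> x; last first.
  case=> m [p [w [Vp w0 w1 ->]]]; split.
    by exists m, p, w; split=> // i; case: (Vp i).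
  rewrite slack_sum // big1 // => i _.
  by case: (Vp i) => _ ->; rewrite mulr0.
case=> -[m [p [w [Vp w0 w1 ->]]]]; rewrite slack_sum // => /eqP.
rewrite psumr_eq0 => [/allP h0|i _]; last by rewrite mulr_ge0 ?hV.
have [i0 wi0] : exists i, w i != 0.
  apply: contrapT => /forallNP w00; have /eqP := w1.
  rewrite big1 ?(eq_sym 0) ?oner_eq0 // => i _; apply/eqP/negPn/negP.
  exact: w00.
pose q i := if w i == 0 then p i0 else p i.
exists m, q, w; split=> //.
- move=> i; rewrite /q; case: (eqVneq (w i) 0) => wi; split=> //; apply/eqP.
    by have := h0 i0 (mem_index_enum _); rewrite mulf_eq0 (negPf wi0).
  by have := h0 i (mem_index_enum _); rewrite mulf_eq0 (negPf wi).
- apply: eq_bigr => i _; rewrite /q; case: (eqVneq (w i) 0) => // ->.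
  by rewrite !scale0r.
Qed.

Lemma convex_hull_sub V W : V `<=` W -> convex_hull V `<=` convex_hull W.
Proof.
by move=> VW x [m [p [w [Vp w0 w1 ->]]]]; exists m, p, w; split=> // i; apply/VW.
Qed.

Lemma convex_hull0 V : convex_hull V !=set0 -> V !=set0.
Proof.
case=> x [[|m] [p [w [Vp _ w1 _]]]]; last by exists (p ord0).
by move/eqP: w1; rewrite big_ord0 eq_sym oner_eq0.
Qed.

Lemma convex_hull1 v : convex_hull [set v] = [set v].
Proof.
apply/seteqP; split=> x; last by move=> ->; exact: sub_convex_hull.
case=> m [p [w [vp _ w1 ->]]] /=.
rewrite (eq_bigr (fun i => w i *: v)); last by move=> i _; rewrite (vp i).
by rewrite -scaler_suml w1 scale1r.
Qed.

Lemma face_hull V F : face (convex_hull V) F -> F = convex_hull (V `&` F).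
Proof.
case/faceP=> h h0 ->; rewrite zeros_hull => [|v /sub_convex_hull/h0//].
congr convex_hull; apply/seteqP; split=> v.
  by move=> [Vv hv]; split=> //; apply: sub_convex_hull.
case=> Vv; rewrite -zeros_hull => [[]//|w /sub_convex_hull/h0//].
Qed.

Lemma face_hull_sub V F G : face (convex_hull V) F -> face (convex_hull V) G ->
  (F `<=` G) <-> (forall v, V v -> F v -> G v).
Proof.
move=> fF fG; split=> [FG v _ /FG//|FG].
by rewrite (face_hull fF) (face_hull fG); apply: convex_hull_sub => v [Vv Fv];
  split=> //; exact: FG.
Qed.

Lemma vertex_hull V v : vertex (convex_hull V) v -> V v.
Proof.
move=> /face_hull e; have : convex_hull (V `&` [set v]) !=set0.
  by exists v; rewrite -e.
by move/convex_hull0 => [x [Vx ex]]; rewrite -ex.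
Qed.

(* A face of a face is cut out by a large multiple of the functional of the big
   face plus the functional of the small one. *)
Lemma tilt (V : set 'rV[R]_n) h h' : finite_set V ->
  (forall v, V v -> 0 <= slack h v) ->
  (forall v, V v -> slack h v = 0 -> 0 <= slack h' v) ->
  exists h'', forall v, V v -> 0 <= slack h'' v /\
    (slack h'' v = 0 <-> slack h v = 0 /\ slack h' v = 0).
Proof.
move=> /finite_seqP[s eV] h0 h'0.
have [N HN] : exists N : R,
    forall v, v \in s -> 0 < slack h v -> 0 < N * slack h v + slack h' v.
  elim: s {eV} => [|u s [N HN]]; first by exists 0.
  (* This multiple of [slack h u] is at least [|slack h' u| + 1], which beats a negative
     [slack h' u]. *)
  exists (Num.max N ((`|slack h' u| + 1) / slack h u)) => v.
  rewrite inE => /orP[/eqP-> hu|vs hv].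
    apply: (@lt_le_trans _ _ (`|slack h' u| + 1 + slack h' u)).
      by have := lerNnormlW (lexx `|slack h' u|); lra.
    rewrite lerD2r; apply: (@le_trans _ _ ((`|slack h' u| + 1) / slack h u * slack h u)).
      by rewrite divfK ?gt_eqF.
    by rewrite ler_pM2r // le_max lexx orbT.
  apply: lt_le_trans (HN v vs hv) _.
  by rewrite lerD2r ler_pM2r // le_max lexx.
exists ((N *: h.1, N * h.2) + h') => v Vv; rewrite slackD slackZ.
have vs : v \in s by move: Vv; rewrite eV.
have := h0 v Vv; rewrite le_eqVlt => /orP[/eqP e|hv].
  by rewrite -e mulr0 add0r; split; [exact: h'0|split=> [->|[]]].
have := HN v vs hv => H; split; first exact: ltW.
by split=> [e|[e]]; [rewrite e ltxx in H|rewrite e ltxx in hv].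
Qed.

Lemma face_trans P F G : polytope P -> face P F -> face F G -> face P G.
Proof.
case=> V fV -> fF; rewrite {1}(face_hull fF) => fG.
case/faceP: (fF) => h h0 eF; case/faceP: fG => h' h'0 eG.
have VP := @sub_convex_hull V.
have [v /VP/h0//|v Vv hv|h'' H] := @tilt V h h' fV.
  by apply: h'0; apply: sub_convex_hull; split=> //; rewrite eF; split=> //; exact: VP.
apply/faceP; exists h''; first by apply: slack_hull_ge0 => v /H[].
rewrite eG !zeros_hull.
- congr convex_hull; apply/seteqP; split=> v.
    by move=> [[Vv]]; rewrite eF => -[_ hv] hv'; split=> //; apply/(H v Vv).2.
  by case=> Vv /(H v Vv).2[hv hv']; split=> //; split=> //; rewrite eF; split=> //;
    exact: VP.
- by move=> v /H[].
- by move=> v; move=> /sub_convex_hull/h'0.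
Qed.

(* A generator of maximal norm is exposed by the functional dot v. *)
Lemma face_vertex P F : polytope P -> face P F -> F !=set0 ->
  exists2 v, vertex P v & F v.
Proof.
move=> pP fF F0; case: (pP) => V fV eP; subst P.
have [u [Vu Fu]] : V `&` F !=set0.
  by apply: convex_hull0; rewrite -(face_hull fF).
have [v [Vv Fv] vmax] : exists2 v, V v /\ F v &
    forall w, V w -> F w -> dot w w <= dot v v.
  have /finite_seqP[s es] : finite_set (V `&` F) by exact: finite_setIl.
  have us : u \in s by have : [set` s] u by rewrite -es.
  have [i is_ H] : exists2 i, i \in s & forall j, j \in s -> dot j j <= dot i i.
    elim: s u us {es Vu Fu} => // a [|b s] IH u _; first by exists a;
      [exact: mem_head|move=> j; rewrite inE => /eqP->].
    have [|i is_ H] := IH b; first exact: mem_head.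
    case: (leP (dot a a) (dot i i)) => ai.
      by exists i => [|j]; rewrite inE ?is_ ?orbT // => /orP[/eqP->|/H].
    exists a => [|j]; first exact: mem_head.
    by rewrite inE => /orP[/eqP->//|/H/le_trans->//]; exact: ltW.
  have : (V `&` F) i by rewrite es.
  case=> Vi Fi; exists i => // w Vw Fw; apply: H.
  by have : [set` s] w by rewrite -es.
(* Both terms on the right are nonnegative by maximality of v, so the slack vanishes only at w =
   v. *)
have sq w : V w -> F w -> 2 * slack (v, dot v v) w =
    dot (v - w) (v - w) + (dot v v - dot w w).
  by move=> _ _; rewrite /slack /= !(dotBl, dotBr) (dotC w v); ring.
exists v => //; apply: face_trans (fF) _ => //; apply/faceP; exists (v, dot v v).
  rewrite {1}(face_hull fF); apply: slack_hull_ge0 => w [Vw Fw].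
  have := sq w Vw Fw; have := vmax w Vw Fw; have := dot_ge0 (v - w); lra.
rewrite {1}(face_hull fF) zeros_hull; last first.
  move=> w [Vw Fw]; have := sq w Vw Fw; have := vmax w Vw Fw;
    have := dot_ge0 (v - w); lra.
rewrite -[LHS]convex_hull1; congr convex_hull; apply/seteqP; split=> w.
  by move=> ->; split=> //; rewrite /slack subrr.
case=> [[Vw Fw]] hw /=; have := sq w Vw Fw; rewrite hw mulr0 => e.
have : dot (v - w) (v - w) == 0.
  by rewrite eq_le dot_ge0 andbT; have := vmax w Vw Fw; lra.
by rewrite dot_eq0 subr_eq0 => /eqP.
Qed.

End Slack.

(** * Dimension *)

Section Dimension.
Context {R : realType} {n : nat}.
Implicit Types (x y v : 'rV[R]_n) (h : 'rV[R]_n * R) (A P F G : set 'rV[R]_n).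

Lemma sub_affine_hull A : A `<=` affine_hull A.
Proof.
move=> x Ax; exists 1%N, (fun=> x), (fun=> 1).
by split=> //; rewrite big_ord_recl big_ord0 addr0 ?scale1r.
Qed.

Lemma slack_affine_hull A h : (forall x, A x -> slack h x = 0) ->
  forall x, affine_hull A x -> slack h x = 0.
Proof.
move=> h0 x [m [p [w [Ap w1 ->]]]]; rewrite slack_sum // big1 // => i _.
by rewrite h0 // mulr0.
Qed.

Lemma has_dimE A d : has_dim A d -> exists U : {vspace 'rV[R]_n},
  [/\ \dim U = d, A !=set0,
      forall x y, affine_hull A x -> affine_hull A y -> x - y \in U &
      forall u, u \in U ->
        exists x y, [/\ affine_hull A x, affine_hull A y & u = x - y]].
Proof.
case=> x0 [U [eA dU]]; exists U.
have x0U u : u \in U -> affine_hull A (x0 + u) by move=> uU; rewrite eA; exists u.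
split=> //.
- case: (x0U 0 (mem0v U)) => -[|m] [p [w [Ap w1 _]]]; last by exists (p ord0).
  by move/eqP: w1; rewrite big_ord0 eq_sym oner_eq0.
- move=> x y; rewrite eA => -[u uU <-] [v vU <-].
  by rewrite opprD addrACA subrr add0r rpredB.
- move=> u uU; exists (x0 + u), (x0 + 0).
  by split; [exact: x0U|exact/x0U/mem0v|rewrite addr0 addrAC subrr add0r].
Qed.

Lemma dimv_add1 (U : {vspace 'rV[R]_n}) u :
  u \notin U -> \dim (U + <[u]>) = (\dim U).+1.
Proof.
move=> uU; have u0 : u != 0 by apply: contraNneq uU => ->; exact: mem0v.
rewrite dimv_disjoint_sum ?dim_vline ?u0 ?addn1 //.
apply/eqP; rewrite -subv0; apply/subvP => w;
  rewrite memv_cap memv0 => /andP[wU /vlineP[c e]].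
apply/eqP; rewrite e; case: (eqVneq c 0) => [->|c0]; first by rewrite scale0r.
by case/negP: uU; rewrite -[u](scalerK c0) -e rpredZ.
Qed.

(** A face strictly between F and P would yield a point g off F and a point p of P off that face.
    The directions from F to g and to p then add two dimensions to that of F, but P has only one
    more. *)
Lemma facet_max P F : facet P F ->
  [/\ F !=set0, F <> P & forall G, face P G -> F `<=` G -> G = F \/ G = P].
Proof.
case=> fF [d [/has_dimE[U [dU P0 PU UP]] /has_dimE[W [dW F0 FW WF]]]].
have FP : F `<=` P := face_sub fF.
have noFP : F <> P.
  move=> e; suff : (\dim U <= \dim W)%N by rewrite dU dW ltnn.
  by apply/dimvS/subvP => u /UP[x [y [Px Py ->]]]; apply: FW; rewrite e.
have dirW h : (forall x, F x -> slack h x = 0) ->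
    forall u, u \in W -> dot h.1 u = 0.
  move=> h0 u /WF[x [y [Fx Fy ->]]].
  have := slack_affine_hull h0 Fx; have := slack_affine_hull h0 Fy.
  by rewrite /slack dotBr; lra.
split=> // G fG FG; apply: contrapT => /not_orP[GF GP].
have [p [Pp nGp]] : exists p, P p /\ ~ G p.
  apply: contrapT => /forallNP H; apply: GP; apply/seteqP; split.
    exact: face_sub.
  by move=> p Pp; apply: contrapT => nGp; exact: (H p).
have [g [Gg nFg]] : exists g, G g /\ ~ F g.
  apply: contrapT => /forallNP H; apply: GF; apply/seteqP; split=> //.
  by move=> g Gg; apply: contrapT => nFg; exact: (H g).
have [f Ff] := F0; have Pg := face_sub fG Gg.
case/faceP: fF => hF _ eF; case/faceP: fG => hG _ eG.
have gW : g - f \notin W.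
  apply/negP => /(dirW hF)-e; apply: nFg; rewrite eF; split=> //.
  have Ff0 : slack hF f = 0 by move: Ff; rewrite eF => -[].
  have : dot hF.1 (g - f) = 0 by apply: e => x; rewrite eF => -[].
  by move: Ff0; rewrite /slack dotBr; lra.
have pW : p - f \notin (W + <[g - f]>)%VS.
  apply/negP => /memv_addP[w wW [_ /vlineP[c ->] e]]; apply: nGp; rewrite eG.
  split=> //.
  have G0 x : G x -> slack hG x = 0 by rewrite eG => -[].
  have e1 := G0 _ (FG _ Ff); have e2 := G0 _ Gg.
  have e3 : dot hG.1 w = 0 by apply: dirW wW => x /FG/G0.
  have : dot hG.1 (p - f) = 0.
    rewrite e dotDr dotZr e3 dotBr; move: e1 e2; rewrite /slack => e1 e2.
    have -> : dot hG.1 g = dot hG.1 f by lra.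
    by rewrite subrr mulr0 addr0.
  by move: e1; rewrite /slack dotBr; lra.
have dd := dimv_add1 pW; rewrite (dimv_add1 gW) dW in dd.
suff : (d.+2 <= d.+1)%N by rewrite ltnn.
have PU' x y : P x -> P y -> x - y \in U.
  by move=> Px Py; apply: PU; exact: sub_affine_hull.
rewrite -dd -dU; apply: dimvS; rewrite !subv_add.
have Pf := FP _ Ff; rewrite -!memvE (PU' g f) ?(PU' p f) // ?andbT.
apply/subvP => u /WF[x [y [[m [q [w [Fq w1 ->]]]] [m' [q' [w' [Fq' w'1 ->]]]] ->]]].
by apply: PU; [exists m, q, w|exists m', q', w']; split=> // i; exact: FP.
Qed.

(** The triangular pattern of zeros makes the points [z i] affinely independent, and there are as
    many as an affine basis of P needs. *)
Lemma affine_span P d (z : 'I_d.+1 -> 'rV[R]_n) (h : 'I_d -> 'rV[R]_n * R) :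
  has_dim P d -> (forall i, P (z i)) ->
  (forall (i : 'I_d) (j : 'I_d.+1), (j <= i)%N -> slack (h i) (z j) = 0) ->
  (forall i : 'I_d, slack (h i) (z (lift ord0 i)) != 0) ->
  forall p, P p -> exists2 w : 'I_d.+1 -> R, \sum_i w i = 1 &
    p = \sum_i w i *: z i.
Proof.
case/has_dimE=> U [dU _ PU _] Pz h0 h1 p Pp.
have PU' x y : P x -> P y -> x - y \in U.
  by move=> Px Py; apply: PU; exact: sub_affine_hull.
pose X := [tuple z (lift ord0 i) - z ord0 | i < d].
have Xi (i : 'I_d) : X`_i = z (lift ord0 i) - z ord0.
  by rewrite -tnth_nth tnth_mktuple.
have fX : free X.
  apply/freeP => k kX; apply: contrapT => /existsNP[i0 /eqP ki0].
  (* [h i] is constant on all points of index at most i, so it kills every term of the relation but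
     the one of largest index. *)
  have [i ki imax] := @arg_maxnP _ i0 (fun i => k i != 0) (@nat_of_ord d) ki0.
  have : dot (h i).1 (\sum_(j < d) k j *: X`_j) = 0 by rewrite kX dot0r.
  under eq_bigr do rewrite Xi.
  rewrite dot_sumr (bigD1 i) //= big1 => [|j ji].
    rewrite addr0 dotZr dotBr => /eqP.
    rewrite mulf_eq0 (negPf ki) /=; have := h1 i; have := h0 i ord0 isT.
    rewrite /slack => e; rewrite -{1}[(h i).2](subrK (dot (h i).1 (z ord0))) e add0r.
    by rewrite -oppr_eq0 opprB => /negPf->.
  case: (eqVneq (k j) 0) => [->|kj]; first by rewrite scale0r dot0r.
  have jle : (j <= i)%N := imax j kj.
  have jlt : (j < i)%N by rewrite ltn_neqAle jle andbT.
  rewrite dotZr dotBr.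
  have := h0 i (lift ord0 j) jlt; have := h0 i ord0 isT.
  rewrite /slack => e1 e2.
  have -> : dot (h i).1 (z (lift ord0 j)) = dot (h i).1 (z ord0) by lra.
  by rewrite subrr mulr0.
have eU : <<X>>%VS = U.
  apply/eqP; rewrite eqEdim dU; move: (fX); rewrite /free size_tuple => /eqP->.
  rewrite leqnn andbT; apply/span_subvP => u /tnthP[i ->].
  by rewrite tnth_mktuple PU'.
have : p - z ord0 \in <<X>>%VS by rewrite eU PU'.
move/coord_span => e.
pose w0 := 1 - \sum_(i < d) coord X i (p - z ord0).
exists (fun i => if unlift ord0 i is Some j then coord X j (p - z ord0) else w0).
  rewrite big_ord_recl unlift_none.
  under eq_bigr do rewrite liftK.
  by rewrite /w0 subrK.
rewrite big_ord_recl unlift_none.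
under eq_bigr do rewrite liftK.
rewrite -[LHS](subrK (z ord0)) {1}e.
have -> : \sum_(i < d) coord X i (p - z ord0) *: X`_i =
    \sum_(i < d) coord X i (p - z ord0) *: z (lift ord0 i) -
    (\sum_(i < d) coord X i (p - z ord0)) *: z ord0.
  rewrite scaler_suml -sumrB; apply: eq_bigr => i _.
  by rewrite Xi scalerBr.
by rewrite /w0 scalerBl scale1r [RHS]addrC -addrA [in LHS](addrC (- _)).
Qed.

End Dimension.

(** * Circles *)

Section Circle.
Context {R : realType}.

(** Vieta: a plane meeting the circle at parameters t and t' has its coefficients fixed by [Y]. *)
Lemma chord_roots (T X U Y t t' : R) : t != t' ->
  X - t * U + T * t ^+ 2 * Y = 0 -> X - t' * U + T * t' ^+ 2 * Y = 0 ->
  U = T * (t + t') * Y /\ X = T * (t * t') * Y.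
Proof.
move=> tt' e1 e2; have : (t - t') * (T * (t + t') * Y - U) == 0.
  by apply/eqP; rewrite -[RHS](subrr 0) -{1}e1 -e2; ring.
rewrite mulf_eq0 subr_eq0 (negPf tt') subr_eq0 => /eqP eU.
split=> //; apply/eqP; rewrite -subr_eq0; apply/eqP; rewrite -e1 -eU; ring.
Qed.

(* The points of a circle through x and y on the side of a are parametrized by
   the ratio tau of their distance ratios to x and y (normalized to be 1 at a);
   after rescaling, affine functionals become quadratic in tau. *)
Lemma circle_param n (x y a a' c : 'rV[R]_n) (r xi mu : R) :
  (forall p, p = x \/ p = y \/ p = a \/ p = a' -> dot (p - c) (p - c) = r) ->
  a' = y + xi *: (x - y) + mu *: (a - y) -> a != y -> a' != y ->
  forall h : 'rV[R]_n * R,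
  let E := dot (x - y) (x - y) in let F := dot (a - y) (a - y) in
  let F' := dot (a' - y) (a' - y) in let T := dot (a - x) (a - x) / F in
  let tau := mu * F / F' in
  E / F' * slack h a' =
    slack h x - tau * (slack h x + T * slack h y - E / F * slack h a)
    + T * tau ^+ 2 * slack h y.
Proof.
move=> sph ea' ay a'y h E F F' T tau.
have F0 : F != 0 by rewrite /F dot_eq0 subr_eq0.
have F'0 : F' != 0 by rewrite /F' dot_eq0 subr_eq0.
have [e ee] : exists e, e = x - y by exists (x - y).
have [f ef] : exists f, f = a - y by exists (a - y).
pose G := dot e f.
have f'E : a' - y = xi *: e + mu *: f.
  by rewrite ea' ee ef addrAC [y + _]addrC addrK.
(* With y as origin the sphere equation equates a squared length with a linear form, so [F'] is
   linear in [xi] and [mu]. *)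
have sph' p : p = x \/ p = y \/ p = a \/ p = a' ->
    dot (p - y) (p - y) = 2 * dot (p - y) (c - y).
  move=> /sph hp; have hy := sph y (or_intror (or_introl erefl)).
  have ep : p - c = (p - y) - (c - y) by rewrite opprB addrA subrK.
  have ey : y - c = - (c - y) by rewrite opprB.
  move: hp hy; rewrite ep ey; move: (p - y) (c - y) => u k.
  by rewrite !(dotBr, dotBl, dotNl, dotNr) !(dotC k); lra.
have eE : E = 2 * dot e (c - y) by rewrite /E ee; apply: sph'; left.
have eF : F = 2 * dot f (c - y) by rewrite /F ef; apply: sph'; right; right; left.
have eF' : F' = xi * E + mu * F.
  rewrite /F' sph'; last by right; right; right.
  by rewrite f'E dotDl !dotZl eE eF; ring.
have eF'2 : F' = xi ^+ 2 * E + 2 * xi * mu * G + mu ^+ 2 * F.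
  by rewrite /F' f'E !(dotDl, dotDr, dotZl, dotZr) (dotC f e) -/G /E /F -ee -ef; ring.
have eT : T = (F - 2 * G + E) / F.
  congr (_ / _); have -> : a - x = f - e by rewrite ef ee opprB addrA subrK.
  by rewrite !(dotBl, dotBr) (dotC f e) -/G /E /F -ee -ef; ring.
have sx : slack h x = slack h y - dot h.1 e by rewrite ee /slack dotBr; ring.
have sa : slack h a = slack h y - dot h.1 f by rewrite ef /slack dotBr; ring.
have sa' : slack h a' = slack h y - (xi * dot h.1 e + mu * dot h.1 f).
  by rewrite -!dotZr -dotDr -f'E /slack dotBr; ring.
(* Eliminating [xi] between the linear and the quadratic expression of [F'] leaves a relation in
   [mu] only. *)
have xE : xi * E = F' - mu * F by rewrite {1}eF'; ring.
have K : E * F' = F' ^+ 2 - 2 * mu * F' * (F - G) + (F - 2 * G + E) * mu ^+ 2 * F.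
  transitivity ((xi * E) ^+ 2 + 2 * (xi * E) * mu * G + mu ^+ 2 * F * E).
    by rewrite eF'2; ring.
  by rewrite xE; ring.
have EY : E / F' = 1 - mu * F / F' * (1 + T - E / F) + T * (mu * F / F') ^+ 2.
  transitivity ((E * F') / F' ^+ 2); first by field.
  by rewrite K eT; field; apply/andP.
have El : E / F' * xi = 1 - mu * F / F'.
  transitivity ((xi * E) / F'); first by field.
  by rewrite xE; field.
transitivity (E / F' * slack h y - E / F' * xi * dot h.1 e - E / F' * mu * dot h.1 f).
  by rewrite sa'; ring.
rewrite El {1}EY sx sa /tau; field; exact/andP.
Qed.

(* (X, Y, U, V) j are the values of the functional of the j-th facet at x and y
   and its two linear coefficients in circle_param; q j is, up to a factor, its
   value at the point where the line joining the vertices {1,2,3,4} and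
   {2,3,4,5} meets the inscribed facet. *)
Lemma no_alternating_wedge (T S t2 t3 t4 s2 s3 s4 : R) (X Y U V : nat -> R) (A B C D : R) :
  let t j := nth 0 [:: 0; 1; t2; t3; t4] j in
  let s j := nth 0 [:: 0; 1; s2; s3; s4] j in
  0 < T -> 0 < S ->
  (forall i, (1 <= i <= 4)%N -> 0 < t i /\ 0 < s i) ->
  X 1%N = 0 -> 0 < X 5%N ->
  (forall j, (1 <= j <= 4)%N -> 0 < Y j) -> 0 <= Y 5%N ->
  (forall i j, (1 <= i <= 4)%N -> (1 <= j <= 5)%N ->
     let ea := X j - t i * U j + T * t i ^+ 2 * Y j in
     let eb := X j - s i * V j + S * s i ^+ 2 * Y j in
     if (i == j) || (i.+1 == j) then ea = 0 /\ eb = 0 else 0 < ea /\ 0 < eb) ->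
  let q j := A * X j + B * Y j + C * U j + D * V j in
  q 1%N < 0 -> 0 < q 5%N -> (forall j, (2 <= j <= 4)%N -> q j = 0) -> False.
Proof.
move=> t s T0 S0 ts0 X1 X5 Y0 Y5 H q q1 q5 q0.
have [t20 s20] := ts0 2%N isT; have [t30 s30] := ts0 3%N isT.
have [t40 s40] := ts0 4%N isT.
have Ya := Y0 1%N isT; have Yb := Y0 2%N isT.
have Yc := Y0 3%N isT; have Yd := Y0 4%N isT.
have [a11 b11] := H 1%N 1%N isT isT.
have [a12 b12] := H 1%N 2%N isT isT; have [a13 b13] := H 1%N 3%N isT isT.
have [a21 b21] := H 2%N 1%N isT isT; have [a31 b31] := H 3%N 1%N isT isT.
have [a41 b41] := H 4%N 1%N isT isT.
have [a22 b22] := H 2%N 2%N isT isT; have [a23 b23] := H 2%N 3%N isT isT.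
have [a33 b33] := H 3%N 3%N isT isT; have [a34 b34] := H 3%N 4%N isT isT.
have [a44 b44] := H 4%N 4%N isT isT; have [a45 b45] := H 4%N 5%N isT isT.
have [a35 b35] := H 3%N 5%N isT isT.
move: q1 q5 (q0 2%N isT) (q0 3%N isT) (q0 4%N isT).
have [a32 b32] := H 3%N 2%N isT isT; have [a42 b42] := H 4%N 2%N isT isT.
have [a43 b43] := H 4%N 3%N isT isT.
rewrite /q {H q0 q ts0 Y0 a13 b13 b35}.
rewrite /t /s /= X1 in a11 b11 a12 b12 a21 b21 a31 b31 a41 b41 a22 b22 a23 b23
  a33 b33 a34 b34 a44 b44 a45 b45 a35 a32 b32 a42 b42 a43 b43
  t20 s20 t30 s30 t40 s40 *.
move=> {t s} q1 q5 q2 q3 q4.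
(* A facet with roots v and w is positive at any other vertex u, so u cannot lie between them; this
   orders the parameters. *)
have gap (T' Y' u v w : R) : 0 < T' -> 0 < Y' ->
    0 < T' * (v * w) * Y' - u * (T' * (v + w) * Y') + T' * u ^+ 2 * Y' ->
    v < u -> w < u.
  move=> T'0 Y'0; have -> : T' * (v * w) * Y' - u * (T' * (v + w) * Y') +
    T' * u ^+ 2 * Y' = (T' * Y') * ((u - v) * (u - w)) by ring.
  rewrite (pmulr_rgt0 _ (mulr_gt0 T'0 Y'0)) => + vu.
  have uv : 0 < u - v by rewrite subr_gt0.
  by rewrite (pmulr_rgt0 _ uv) subr_gt0.
have gap1 (T' Y' U' u : R) : 0 < T' -> 0 < Y' -> 0 < u ->
    0 - 1 * U' + T' * 1 ^+ 2 * Y' = 0 ->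
    0 < 0 - u * U' + T' * u ^+ 2 * Y' -> 1 < u.
  move=> T'0 Y'0 u0 e; have -> : U' = T' * Y' by clear -e; lra.
  have -> : 0 - u * (T' * Y') + T' * u ^+ 2 * Y' = (T' * Y' * u) * (u - 1) by ring.
  by rewrite (pmulr_rgt0 _ (mulr_gt0 (mulr_gt0 T'0 Y'0) u0)) subr_gt0.
have t12 := gap1 _ _ _ _ T0 Ya t20 a11 a21.
have s12 := gap1 _ _ _ _ S0 Ya s20 b11 b21.
have [eU2 eX2] := chord_roots (negbT (lt_eqF t12)) a12 a22.
have [eV2 eX2'] := chord_roots (negbT (lt_eqF s12)) b12 b22.
rewrite eU2 eX2 in a32 a42; rewrite eV2 eX2' in b32 b42.
have t13 := gap1 _ _ _ _ T0 Ya t30 a11 a31.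
have s13 := gap1 _ _ _ _ S0 Ya s30 b11 b31.
have t23 := gap _ _ _ _ _ T0 Yb a32 t13.
have s23 := gap _ _ _ _ _ S0 Yb b32 s13.
have [eU3 eX3] := chord_roots (negbT (lt_eqF t23)) a23 a33.
have [eV3 eX3'] := chord_roots (negbT (lt_eqF s23)) b23 b33.
rewrite eU3 eX3 in a43; rewrite eV3 eX3' in b43.
have t14 := gap1 _ _ _ _ T0 Ya t40 a11 a41.
have s14 := gap1 _ _ _ _ S0 Ya s40 b11 b41.
have t24 := gap _ _ _ _ _ T0 Yb a42 t14.
have s24 := gap _ _ _ _ _ S0 Yb b42 s14.
have t34 := gap _ _ _ _ _ T0 Yc a43 t24.
have s34 := gap _ _ _ _ _ S0 Yc b43 s24.
have [eU4 eX4] := chord_roots (negbT (lt_eqF t34)) a34 a44.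
have [eV4 eX4'] := chord_roots (negbT (lt_eqF s34)) b34 b44.
(* The value of a facet at x is computed from each of the two circles, which equates the products of
   its two roots up to the factors T and S. *)
have p2 : T * t2 = S * s2.
  by apply: (mulIf (lt0r_neq0 Yb)); move: eX2'; rewrite eX2 !mul1r.
have p3 : T * (t2 * t3) = S * (s2 * s3).
  by apply: (mulIf (lt0r_neq0 Yc)); rewrite -eX3.
have p4 : T * (t3 * t4) = S * (s3 * s4).
  by apply: (mulIf (lt0r_neq0 Yd)); rewrite -eX4.
(* Dividing consecutive product relations makes t_i / s_i alternate: it is 1 at odd i by the
   normalization at i = 1, and K at even i. *)
have es3 : s3 = t3.
  apply: (mulfI (lt0r_neq0 (mulr_gt0 S0 s20))).
  by rewrite -mulrA -p3 -p2 mulrA.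
have [K eS] : exists K, S = K * T by exists (S / T); rewrite divfK ?gt_eqF.
have et2 : t2 = K * s2.
  by apply: (mulfI (lt0r_neq0 T0)); rewrite p2 eS; ring.
have et4 : t4 = K * s4.
  apply: (mulfI (lt0r_neq0 (mulr_gt0 T0 t30))).
  by rewrite -mulrA p4 es3 eS; ring.
have {}q1 : B + C * T + D * S < 0.
  rewrite -(pmulr_llt0 _ Ya); move: q1; congr (_ < 0).
  have -> : U 1%N = T * Y 1%N by clear -a11; lra.
  have -> : V 1%N = S * Y 1%N by clear -b11; lra.
  by ring.
have Q (X' Y' U' V' p u v : R) : 0 < Y' -> X' = p * Y' -> U' = T * u * Y' ->
    V' = S * v * Y' -> A * X' + B * Y' + C * U' + D * V' = 0 ->
    A * p + B + C * T * u + D * S * v = 0.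
  move=> Y'0 -> -> -> e; apply: (mulIf (lt0r_neq0 Y'0)); rewrite mul0r -e; ring.
have {}q2 := Q _ _ _ _ _ _ _ Yb eX2 eU2 eV2 q2.
have {}q3 := Q _ _ _ _ _ _ _ Yc eX3 eU3 eV3 q3.
have {}q4 := Q _ _ _ _ _ _ _ Yd eX4 eU4 eV4 q4.
(* [L1] to [L4] give the signs of A t_i + C + D t_i / s_i for i = 1, ..., 4. Each comes from the
   difference of the scaled values of q on the two facets through the points with index i. *)
have L1 : 0 < A + C + D.
  have Tt2 : 0 < T * t2 by exact: mulr_gt0.
  rewrite -(pmulr_rgt0 _ Tt2).
  have : (T * t2) * (A + C + D) = (A * (T * (1 * t2)) + B + C * T * (1 + t2) + D * S * (1 + s2)) - (B + C * T + D * S).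
    by rewrite eS et2; ring.
  by rewrite q2 => ->; rewrite sub0r oppr_gt0.
have L2 : A * t2 + C + D * K = 0.
  have m0 : 0 < T * (t3 - 1) by rewrite mulr_gt0 ?subr_gt0 // (lt_trans t12).
  apply: (mulfI (lt0r_neq0 m0)); rewrite mulr0 -[RHS](subrr 0) -{1}q3 -q2.
  by rewrite eS es3 et2; ring.
have L3 : A * t3 + C + D = 0.
  have m0 : 0 < T * (t4 - t2) by rewrite mulr_gt0 ?subr_gt0.
  apply: (mulfI (lt0r_neq0 m0)); rewrite mulr0 -[RHS](subrr 0) -{1}q4 -q3.
  by rewrite eS es3 et4 et2; ring.
have L4 : 0 < A * t4 + C + D * K.
  (* [Y 5] may vanish (for k = 8 facet 5 contains y), so facet 5 is handled through its root t4
     alone and its positivity at t3. *)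
  have d0 : 0 < X 5%N - T * (t3 * t4) * Y 5%N.
    have d34 : 0 < t4 - t3 by rewrite subr_gt0.
    rewrite -(pmulr_rgt0 _ d34); move: (mulr_gt0 t40 a35); congr (0 < _).
    have eU5 : t4 * U 5%N = X 5%N + T * t4 ^+ 2 * Y 5%N by clear -a45; lra.
    transitivity (t4 * X 5%N - t3 * (t4 * U 5%N) + T * t3 ^+ 2 * t4 * Y 5%N);
      first by ring.
    by rewrite eU5; ring.
  rewrite -(pmulr_lgt0 _ d0); move: (mulr_gt0 t40 q5); congr (0 < _).
  have eU5 : t4 * U 5%N = X 5%N + T * t4 ^+ 2 * Y 5%N by clear -a45; lra.
  have eV5 : s4 * V 5%N = X 5%N + S * s4 ^+ 2 * Y 5%N by clear -b45; lra.
  have eB : B = - (A * (T * (t3 * t4)) + C * T * (t3 + t4) + D * S * (s3 + s4)) by clear -q4; lra.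
  transitivity (t4 * (A * X 5%N + B * Y 5%N) + C * (t4 * U 5%N) + D * K * (s4 * V 5%N)).
    by rewrite et4; ring.
  by rewrite eU5 eV5 eB eS es3 et4; ring.
(* [L1] and [L3] give A (1 - t3) > 0, whereas [L2] and [L4] give A (t4 - t2) > 0. *)
clear -L1 L2 L3 L4 t13 t24; nra.
Qed.
End Circle.

(** * Faces of cyclic polytopes *)

Section Cyclic.
Context {R : realType} {k : nat} (t : 'I_k -> R).
Implicit Types (p : {poly R}) (D G : set 'rV[R]_4).
Local Notation m := (moment_curve 4).
Local Notation C := (cyclic_polytope t : set 'rV[R]_4).

(** On the moment curve affine functionals are the polynomials of degree at most 4, so faces become
    zero sets of nonnegative polynomials. *)
Lemma slack_moment p : (size p <= 5)%N ->
  exists h : 'rV[R]_4 * R, forall x, slack h (m x) = p.[x].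
Proof.
move=> sp; exists (\row_i - p`_i.+1, p`_0) => x.
rewrite (horner_coef_wide x sp) big_ord_recl expr0 mulr1 /slack /= -sumrN.
by congr (_ + _); apply: eq_bigr => i _; rewrite !mxE mulNr opprK.
Qed.

Lemma moment_slack (h : 'rV[R]_4 * R) :
  exists2 p : {poly R}, (size p <= 5)%N & forall x, slack h (m x) = p.[x].
Proof.
pose c i := if i is j.+1 then - h.1 0 (inord j) else h.2.
exists (\poly_(i < 5) c i) => [|x]; first exact: size_poly.
rewrite horner_poly big_ord_recl /= expr0 mulr1 /slack -sumrN.
by congr (_ + _); apply: eq_bigr => i _; rewrite !mxE inord_val mulNr.
Qed.

Lemma poly_face p : (size p <= 5)%N -> (forall i, 0 <= p.[t i]) ->
  exists2 D, face C D & forall i, D (m (t i)) <-> p.[t i] = 0.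
Proof.
move=> /slack_moment[h ph] p0; exists (zeros C h).
  apply/faceP; exists h => //; apply: slack_hull_ge0 => _ [i _ <-].
  by rewrite ph.
move=> i; rewrite -ph; split=> [[]//|e]; split=> //.
by apply: sub_convex_hull; exists i.
Qed.

Lemma face_poly D : face C D -> exists p : {poly R},
  [/\ (size p <= 5)%N, forall i, 0 <= p.[t i] &
      forall i, D (m (t i)) <-> p.[t i] = 0].
Proof.
move=> /faceP[h h0 ->]; have [p sp ph] := moment_slack h; exists p; split=> // i.
  by rewrite -ph; apply/h0/sub_convex_hull; exists i.
rewrite -ph; split=> [[]//|e]; split=> //.
by apply: sub_convex_hull; exists i.
Qed.

Lemma cyclic_face_sub D G : face C D -> face C G ->
  (D `<=` G) <-> (forall i, D (m (t i)) -> G (m (t i))).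
Proof.
move=> fD fG; rewrite (face_hull_sub fD fG); split=> H.
  by move=> i; apply: H; exists i.
by move=> _ [i _ <-]; exact: H.
Qed.

Lemma vertex_face i : face C [set m (t i)].
Proof.
have [||D fD HD] := @poly_face (('X - (t i)%:P) ^+ 2).
- by rewrite size_exp_XsubC.
- by move=> j; rewrite horner_exp sqr_ge0.
suff <- : D = [set m (t i)] by [].
rewrite (face_hull fD) -[RHS]convex_hull1; congr convex_hull.
apply/seteqP; split=> [_ [[j _ <-] /HD]|_ ->] /=.
  by rewrite horner_exp hornerXsubC => /eqP; rewrite sqrf_eq0 subr_eq0 => /eqP->.
by split; [exists i|apply/HD; rewrite horner_exp hornerXsubC subrr expr0n].
Qed.

Lemma nonempty_face D : face C D -> D !=set0 -> exists i, D (m (t i)).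
Proof.
move=> fD; rewrite {1}(face_hull fD) => /convex_hull0[_ [[i _ <-] Di]].
by exists i.
Qed.

(** A polynomial of degree at most 4 with five roots is zero. *)
Lemma face_full D rs : face C D -> uniq rs -> size rs = 5 ->
  (forall x, x \in rs -> exists2 i, x = t i & D (m (t i))) -> D = C.
Proof.
move=> fD urs srs H; apply/seteqP; split; first exact: face_sub.
have [p [sp _ Dp]] := face_poly fD.
have p0 : p = 0.
  apply: contraTeq sp => p0; rewrite -ltnNge.
  have := @max_poly_roots _ p rs p0; rewrite srs; apply=> //.
  by apply/allP => x /H[i -> /Dp e]; apply/rootP.
apply/(cyclic_face_sub (face_self _) fD) => i _.
by apply/Dp; rewrite p0 horner0.
Qed.

(** Any larger face has a fifth root, hence is everything. *)
Lemma face_coatom D rs : face C D -> uniq rs -> size rs = 4 ->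
  (forall x, x \in rs -> exists2 i, x = t i & D (m (t i))) ->
  forall G, face C G -> D `<=` G -> G = D \/ G = C.
Proof.
move=> fD urs srs H G fG DG.
case: (pselect (exists2 i, G (m (t i)) & t i \notin rs)) => [[i Gi irs]|nG].
  right; apply: (@face_full G (t i :: rs)) => //=; [by rewrite irs|by rewrite srs|].
  move=> x; rewrite inE => /orP[/eqP->|/H[j -> /DG]]; [by exists i|by exists j].
left; apply/seteqP; split=> //; apply/(cyclic_face_sub fG fD) => i Gi.
have : t i \in rs by apply: contrapT => /negP irs; apply: nG; exists i.
by move=> /H[j ->].
Qed.

End Cyclic.

(* The substitution s = -1 / (t - t i0) sends t i0 to infinity and turns the cyclic
   order of the remaining parameters, starting after t i0, into a linear one. *)
Lemma reparametrization {R : realType} k (t : 'I_k -> R) (i0 : 'I_k) :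
  injective t -> exists s : nat -> R,
  [/\ forall j, (j < k.-1)%N -> s j != 0,
      forall i j, (i < j < k.-1)%N -> s i < s j &
      forall x, range t x <-> x = t i0 \/ exists2 j, (j < k.-1)%N & x = t i0 - (s j)^-1].
Proof.
move=> tinj; pose f i := (t i0 - t i)^-1.
have finj : injective f by move=> i j /invr_inj/addrI/oppr_inj/tinj.
pose l := sort <=%O [seq f i | i <- enum (predC1 i0)].
have sl : size l = k.-1 by rewrite size_sort size_map -cardE cardC1 card_ord.
have ml x : x \in l = (x \in [seq f i | i <- enum (predC1 i0)]) by rewrite mem_sort.
have memP x : x \in l -> exists2 i, i != i0 & x = f i.
  by rewrite ml => /mapP[i]; rewrite mem_enum inE => ii ->; exists i.
have lsort : path.sorted <%O l.
  by rewrite lt_sorted_uniq_le sort_uniq map_inj_uniq ?enum_uniq //= sort_le_sorted.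
exists (nth 0 l); split.
- move=> j jk; have /memP[i ii ->] : nth 0 l j \in l by rewrite mem_nth ?sl.
  by rewrite invr_eq0 subr_eq0 (inj_eq tinj) eq_sym.
- by move=> i j /andP[ij jk]; rewrite lt_sorted_ltn_nth ?inE ?sl // (ltn_trans ij).
- move=> x; split=> [[i _ <-]|[->|[j jk ->]]].
  + case: (eqVneq i i0) => [->|ii]; [by left|right].
    have : f i \in l by rewrite ml map_f // mem_enum.
    move=> fl; exists (index (f i) l); first by rewrite -sl index_mem.
    by rewrite nth_index // invrK opprB addrC subrK.
  + by exists i0.
  + have /memP[i ii ->] : nth 0 l j \in l by rewrite mem_nth ?sl.
    by exists i => //; rewrite invrK opprB addrC subrK.
Qed.

(** * The facet-vertex incidences of the wedge *)

(* Whether the i-th vertex on the c-th circle of a wedge with N facets lies on the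
   j-th facet. Facets 0 and N - 1 carry the circles false and true; on both
   circles i = 0 is the vertex x and i = N - 2 the vertex y. *)
Definition tight (N : nat) (c : bool) (i j : nat) : bool :=
  [|| (j == 0) && [|| ~~ c, i == 0 | i == N.-2],
      (j == N.-1) && [|| c, i == 0 | i == N.-2] |
      (0 < j < N.-1) && ((j == i) || (j == i.+1))]%N.

Lemma ord3P (P : 'I_3 -> Prop) :
  P (Ordinal (isT : (0 < 3)%N)) -> P (Ordinal (isT : (1 < 3)%N)) ->
  P (Ordinal (isT : (2 < 3)%N)) -> forall i, P i.
Proof.
move=> P0 P1 P2 [[|[|[|i]]] Hi] //.
- by rewrite (_ : Ordinal Hi = Ordinal (isT : (0 < 3)%N)) //; apply: val_inj.
- by rewrite (_ : Ordinal Hi = Ordinal (isT : (1 < 3)%N)) //; apply: val_inj.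
- by rewrite (_ : Ordinal Hi = Ordinal (isT : (2 < 3)%N)) //; apply: val_inj.
Qed.

(* The wedge is simple: each vertex lies on three facets, and for each of them
   there is a vertex on the two others only. *)
Lemma tight_simple N c i : (4 <= N)%N -> (i <= N.-2)%N ->
  exists (J : 'I_3 -> nat) (W : 'I_3 -> bool * nat),
    [/\ forall l, (J l < N)%N, forall l, ((W l).2 <= N.-2)%N,
        forall j, (j < N)%N -> tight N c i j -> exists l, j = J l,
        forall l, tight N c i (J l) &
        forall l l', tight N (W l).1 (W l).2 (J l') = (l != l')].
Proof.
move=> N4 iN.
have mk j0 j1 j2 w0 w1 w2 :
    [&& j0 < N, j1 < N, j2 < N, w0.2 <= N.-2, w1.2 <= N.-2 & w2.2 <= N.-2]%N ->
    (forall j, (j < N)%N -> tight N c i j = [|| j == j0, j == j1 | j == j2]) ->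
    [&& ~~ tight N w0.1 w0.2 j0, tight N w0.1 w0.2 j1 & tight N w0.1 w0.2 j2] ->
    [&& tight N w1.1 w1.2 j0, ~~ tight N w1.1 w1.2 j1 & tight N w1.1 w1.2 j2] ->
    [&& tight N w2.1 w2.2 j0, tight N w2.1 w2.2 j1 & ~~ tight N w2.1 w2.2 j2] ->
    exists (J : 'I_3 -> nat) (W : 'I_3 -> bool * nat),
    [/\ forall l, (J l < N)%N, forall l, ((W l).2 <= N.-2)%N,
        forall j, (j < N)%N -> tight N c i j -> exists l, j = J l,
        forall l, tight N c i (J l) &
        forall l l', tight N (W l).1 (W l).2 (J l') = (l != l')].
  move=> /and5P[? ? ? ? /andP[? ?]] T /and3P[/negbTE ? ? ?] /and3P[? /negbTE ? ?] /and3P[? ? /negbTE ?].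
  exists (fun l => nth 0%N [:: j0; j1; j2] l), (fun l => nth w0 [:: w0; w1; w2] l).
  split; try by apply: ord3P.
  - move=> j jN; rewrite T // => /or3P[] /eqP->.
    + by exists (Ordinal (isT : (0 < 3)%N)).
    + by exists (Ordinal (isT : (1 < 3)%N)).
    + by exists (Ordinal (isT : (2 < 3)%N)).
  - by apply: ord3P => /=; rewrite T // eqxx ?orbT.
  - by apply: ord3P; apply: ord3P.
case: (eqVneq i 0%N) => [i0|i0].
  apply: (mk 0 1 N.-1 (true, 1) (true, N.-2) (false, 1))%N; rewrite /tight /=; lia.
case: (eqVneq i N.-2) => [iM|iM].
  apply: (mk 0 i N.-1 (true, i.-1) (true, 0) (false, i.-1))%N; rewrite /tight /=; lia.
case: c mk => mk.
  apply: (mk N.-1 i i.+1 (false, i) (true, i.+1) (true, i.-1))%N; rewrite /tight /=;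
    lia.
apply: (mk 0 i i.+1 (true, i) (false, i.+1) (false, i.-1))%N; rewrite /tight /=; lia.
Qed.

(** * Cubics on an ordered grid that realize the [tight] sets *)

Section Gale.
Context {R : realType} (N : nat) (s : nat -> R).
Context (smono : forall i j, (i < j < N)%N -> s i < s j).

Lemma grid_eq i j : (i < N)%N -> (j < N)%N -> (s i == s j) = (i == j).
Proof.
move=> iN jN; case: (ltngtP i j) => [ij|ij|->]; last by rewrite eqxx.
- by rewrite lt_eqF // smono ?ij.
- by rewrite gt_eqF // smono ?ij.
Qed.

(** The product is negative only between two neighbouring grid points, where there is no grid
    point. *)
Lemma grid_gap i j : (i.+1 < N)%N -> (j < N)%N ->
  0 <= (s j - s i) * (s j - s i.+1).
Proof.
move=> iN jN; case: (ltngtP j i) => [ji|ij|->]; last by rewrite subrr mul0r.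
  have := @smono j i; have := @smono j i.+1; rewrite ji iN (ltnW iN) ltnS (ltnW ji).
  by move=> /(_ isT) ? /(_ isT) ?; rewrite mulr_le0 // subr_le0 ltW.
have := @smono i j; rewrite ij jN => /(_ isT) ?.
move: ij; rewrite leq_eqVlt => /orP[/eqP<-|ij]; first by rewrite subrr mulr0.
have := @smono i.+1 j; rewrite ij jN => /(_ isT) ?.
by rewrite mulr_ge0 // subr_ge0 ltW.
Qed.

Lemma gale_cubic c i : (4 <= N)%N -> (i <= N.-2)%N -> exists kappa a b d : R,
  forall j, (j < N)%N ->
    0 <= kappa * ((s j - a) * (s j - b) * (s j - d)) /\
    (kappa * ((s j - a) * (s j - b) * (s j - d)) = 0 <-> tight N c i j).
Proof.
move=> N4 iN.
have s0j j : (j < N)%N -> 0 <= s j - s 0%N.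
  by case: j => [|j] jN; rewrite subr_ge0 // ltW // smono.
have sNj j : (j < N)%N -> 0 <= s N.-1 - s j.
  move=> jN; rewrite subr_ge0; case: (eqVneq j N.-1) => [->//|jN1].
  by rewrite ltW // smono; lia.
(* The third root is an end of the grid outside the pair i, i + 1. At x and y the end that c would
   select may already belong to the pair; then the other end is taken. *)
case: (boolP (if c then i == N.-2 else i != 0%N)) => ci.
  exists 1, (s 0%N), (s i), (s i.+1) => j jN; rewrite mul1r -mulrA; split.
    by rewrite mulr_ge0 ?s0j ?grid_gap //; lia.
  apply: iff_trans (rwP eqP) _; rewrite !mulf_eq0 !subr_eq0 !grid_eq; try lia.
  rewrite /tight; case: c ci => ci; lia.
exists (-1), (s N.-1), (s i), (s i.+1) => j jN.
have -> : -1 * ((s j - s N.-1) * (s j - s i) * (s j - s i.+1)) =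
  (s N.-1 - s j) * ((s j - s i) * (s j - s i.+1)) by ring.
split.
  by rewrite mulr_ge0 ?sNj ?grid_gap //; lia.
apply: iff_trans (rwP eqP) _; rewrite !mulf_eq0 !subr_eq0 !grid_eq; try lia.
rewrite /tight; case: c ci => ci; lia.
Qed.

End Gale.

(** * Gale's evenness condition: the converse for zero sets *)

Section GaleEvenness.
Context {R : realType} (N : nat) (s : nat -> R).
Context (smono : forall i j, (i < j < N)%N -> s i < s j).

(** A cubic changes sign at each root. If [al] is positive, no grid point may precede x or lie
    between y and z; if negative, none may lie between x and y or follow z. *)
Lemma triple_evenness x y z (al : R) : (x < y < z)%N -> (z < N)%N -> al != 0 ->
  (forall j, (j < N)%N -> 0 <= (s j - s x) * (s j - s y) * (al * (s j - s z))) ->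
  (x = 0%N /\ z = y.+1) \/ (y = x.+1 /\ z = N.-1).
Proof.
move=> /andP[xy yz] zN al0 H.
have pos i j : (i < j)%N -> (j < N)%N -> 0 < s j - s i.
  by move=> ij jN; rewrite subr_gt0 smono ?ij.
have Hn j : (j < N)%N -> 0 < (s x - s j) * (s y - s j) * (s z - s j) -> al <= 0.
  move=> jN p; rewrite -(pmulr_lle0 _ p) -oppr_ge0.
  by move: (H j jN); congr (0 <= _); ring.
have [alp|aln] : 0 < al \/ al < 0 by case: (ltgtP al 0) al0; auto.
- left; split.
    apply/eqP; rewrite -leqn0 leqNgt; apply/negP => x0.
    have: al <= 0 by apply: (Hn 0%N) => //; [lia|rewrite !mulr_gt0 ?pos //; lia].
    by rewrite leNgt alp.
  apply/eqP; rewrite eqn_leq yz andbT leqNgt; apply/negP => yz1.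
  have: 0 <= - al.
    have p : 0 < (s y.+1 - s x) * (s y.+1 - s y) * (s z - s y.+1).
      by rewrite !mulr_gt0 ?pos //; lia.
    rewrite -(pmulr_rge0 _ p); move: (H y.+1 (ltn_trans yz1 zN)); congr (0 <= _); ring.
  by rewrite oppr_ge0 leNgt alp.
- right; split.
    apply/eqP; rewrite eqn_leq xy andbT leqNgt; apply/negP => yz1.
    have: 0 <= al.
      have p : 0 < (s x.+1 - s x) * (s y - s x.+1) * (s z - s x.+1).
        by rewrite !mulr_gt0 ?pos //; lia.
      rewrite -(pmulr_rge0 _ p); have := H x.+1; have -> : (x.+1 < N)%N by lia.
      by move=> /(_ isT); congr (0 <= _); ring.
    by rewrite leNgt aln.
  apply/eqP; rewrite eqn_leq; apply/andP; split; first by lia.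
  rewrite leqNgt; apply/negP => zN1.
  have: 0 <= al.
    have zN' : (z.+1 < N)%N by lia.
    have p : 0 < (s z.+1 - s x) * (s z.+1 - s y) * (s z.+1 - s z).
      by rewrite !mulr_gt0 ?pos //; lia.
    by rewrite -(pmulr_rge0 _ p); move: (H z.+1 zN'); congr (0 <= _); ring.
  by rewrite leNgt aln.
Qed.

(** Otherwise the linear factor is positive at both ends of the grid and negative at x + 1, which an
    affine function cannot be. *)
Lemma pair_evenness x y (al be : R) : (x < y < N)%N ->
  (forall j, (j < N)%N -> 0 <= (s j - s x) * (s j - s y) * (al * s j + be)) ->
  (forall j, (j < N)%N -> al * s j + be = 0 -> j = x \/ j = y) ->
  [\/ y = x.+1, x = 0%N | y = N.-1].
Proof.
move=> /andP[xy yN] H H0.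
have pos i j : (i < j)%N -> (j < N)%N -> 0 < s j - s i.
  by move=> ij jN; rewrite subr_gt0 smono ?ij.
case: (eqVneq y x.+1) => [->|yx]; first by constructor 1.
case: (eqVneq x 0%N) => [->|x0]; first by constructor 2.
case: (eqVneq y N.-1) => [->|yN1]; first by constructor 3.
have x0' : (0 < x)%N by lia.
have yx' : (x.+1 < y)%N by lia.
have yN' : (y < N.-1)%N by lia.
have N1 : (N.-1 < N)%N by lia.
have e0 : 0 < al * s 0%N + be.
  rewrite lt_neqAle; apply/andP; split.
    by apply/eqP => /esym/H0 []; lia.
  have p : 0 < (s x - s 0%N) * (s y - s 0%N) by rewrite mulr_gt0 ?pos //; lia.
  rewrite -(pmulr_rge0 _ p); have := H 0%N; have -> : (0 < N)%N by lia.
  by move=> /(_ isT); congr (0 <= _); ring.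
have e2 : 0 < al * s N.-1 + be.
  rewrite lt_neqAle; apply/andP; split.
    by apply/eqP => /esym/H0; case; lia.
  have p : 0 < (s N.-1 - s x) * (s N.-1 - s y) by rewrite mulr_gt0 ?pos //; lia.
  by rewrite -(pmulr_rge0 _ p); exact: H.
have e1 : al * s x.+1 + be < 0.
  rewrite lt_neqAle; apply/andP; split.
    by apply/eqP => /H0; case; lia.
  have p : 0 < (s x.+1 - s x) * (s y - s x.+1) by rewrite mulr_gt0 ?pos //; lia.
  rewrite -oppr_ge0 -(pmulr_rge0 _ p); have := H x.+1; have -> : (x.+1 < N)%N by lia.
  by move=> /(_ isT); congr (0 <= _); ring.
have := pos 0%N x.+1 isT; have -> : (x.+1 < N)%N by lia.
have := pos x.+1 N.-1; have -> : (x.+1 < N.-1)%N by lia.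
move=> /(_ isT N1) p1 /(_ isT) p0.
suff : (al * s x.+1 + be) * (s N.-1 - s 0%N) =
  (al * s 0%N + be) * (s N.-1 - s x.+1) + (al * s N.-1 + be) * (s x.+1 - s 0%N).
  have : 0 < s N.-1 - s 0%N by lra.
  move=> p2 e; have := addr_gt0 (mulr_gt0 e0 p1) (mulr_gt0 e2 p0).
  by rewrite -e pmulr_lgt0 // ltNge ltW.
ring.
Qed.

(** Two zeros leave a linear factor. A third zero fixes it up to a scalar, and scalar 0 gives the
    whole grid; exactly two zeros are the case of [pair_evenness]; fewer always fit. *)
Lemma gale_evenness (Z : pred nat) : (4 <= N)%N ->
  (forall x y, (x < y < N)%N -> Z x -> Z y -> exists al be : R, forall j, (j < N)%N ->
    0 <= (s j - s x) * (s j - s y) * (al * s j + be) /\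
    Z j = ((s j - s x) * (s j - s y) * (al * s j + be) == 0)) ->
  (forall j, (j < N)%N -> Z j) \/
  exists c i, (i <= N.-2)%N /\ forall j, (j < N)%N -> Z j -> tight N c i j.
Proof.
move=> N4 H.
have [[x [y [xyN Zx Zy]]]|no2] := pselect (exists x y, [/\ (x < y < N)%N, Z x & Z y]); last first.
  right; case: (pselect (exists2 x, (x < N)%N & Z x)) => [[x xN Zx]|no1]; last first.
    by exists true, 0%N; split=> // j jN Zj; case: no1; exists j.
  have only j : (j < N)%N -> Z j -> j = x.
    move=> jN Zj; case: (ltngtP j x) => // jx; case: no2.
      by exists j, x; rewrite jx.
    by exists x, j; rewrite jx.
  case: (eqVneq x N.-1) => xN1.
    exists true, 0%N; split=> // j jN /(only j jN)->; rewrite /tight; lia.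
  exists false, x; split; first by lia.
  by move=> j jN /(only j jN)->; rewrite /tight; lia.
case: (pselect (exists z, [/\ (z < N)%N, z != x, z != y & Z z])) => [[z [zN zx zy Zz]]|no3].
  have [{zN zx zy Zz Zx Zy xyN}x' [y' [z' [xyz zN Zx Zy Zz]]]] :
      exists x' y' z', [/\ (x' < y' < z')%N, (z' < N)%N, Z x', Z y' & Z z'].
    case: (ltngtP z x) zx => // zx _; first by exists z, x, y; split=> //; lia.
    case: (ltngtP z y) zy => // zy _; first by exists x, z, y; split=> //; lia.
    by exists x, y, z; split=> //; lia.
  have [] := H x' y' _ Zx Zy; first by lia.
  move=> al [be Hab]; have [_] := Hab z' zN; rewrite Zz => /esym.
  have xz : (x' < z' < N)%N by lia.
  have yz : (y' < z' < N)%N by lia.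
  rewrite !mulf_eq0 !subr_eq0 (gt_eqF (smono xz)) (gt_eqF (smono yz)) /= => /eqP ebe.
  have {ebe}ebe w : al * w + be = al * (w - s z').
    by rewrite -[RHS]addr0 -ebe; ring.
  case: (eqVneq al 0) => [al0|al0].
    by left => j jN; rewrite (Hab j jN).2 ebe al0 mul0r mulr0.
  have Zonly j : (j < N)%N -> Z j -> [|| j == x', j == y' | j == z'].
    move=> jN; rewrite (Hab j jN).2 ebe !mulf_eq0 (negPf al0) /= !subr_eq0.
    by rewrite !(grid_eq smono) ?orbA //; lia.
  have Hal j : (j < N)%N -> 0 <= (s j - s x') * (s j - s y') * (al * (s j - s z')).
    by move=> jN; rewrite -ebe; exact: (Hab j jN).1.
  right; have [[x0 zy]|[x0 zy]] := triple_evenness xyz zN al0 Hal.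
  - exists false, y'; split; first by lia.
    by move=> j jN /(Zonly j jN); rewrite /tight; lia.
  - exists true, x'; split; first by lia.
    by move=> j jN /(Zonly j jN); rewrite /tight; lia.
right; have [al [be Hab]] := H x y xyN Zx Zy.
have Zonly j : (j < N)%N -> Z j -> (j == x) || (j == y).
  move=> jN Zj; apply: contrapT => /negP/norP[jx jy]; apply: no3.
  by exists j; split.
have [||e|e|e] := @pair_evenness x y al be xyN.
- by move=> j /Hab[].
- move=> j jN e; have : Z j by rewrite (Hab j jN).2 e mulr0.
  by move=> /(Zonly j jN)/orP[]/eqP->; [left|right].
- exists true, x; split; first by lia.
  by move=> j jN /(Zonly j jN); rewrite /tight; lia.
- case: (eqVneq y N.-1) => yN1.
    by exists true, 0%N; split=> // j jN /(Zonly j jN); rewrite /tight; lia.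
  exists false, y; split; first by lia.
  by move=> j jN /(Zonly j jN); rewrite /tight; lia.
- exists true, x; split; first by lia.
  by move=> j jN /(Zonly j jN); rewrite /tight; lia.
Qed.

End GaleEvenness.

(** * The faces of the cyclic polytope at one vertex *)

Section CyclicLink.
Context {R : realType} {k : nat} (t : 'I_k -> R) (i0 : 'I_k) (s : nat -> R).
Local Notation m := (moment_curve 4).
Local Notation C := (cyclic_polytope t : set 'rV[R]_4).
Local Notation t0 := (t i0).
Local Notation N := k.-1.
Local Notation pt j := (t i0 - (s j)^-1).
Context (N7 : (7 <= N)%N).
Context (s0 : forall j, (j < N)%N -> s j != 0).
Context (smono : forall i j, (i < j < N)%N -> s i < s j).
Context (rangeE : forall x, range t x <-> x = t0 \/ exists2 j, (j < N)%N & x = pt j).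

Lemma param_face (p : {poly R}) : (size p <= 5)%N -> 0 <= p.[t0] ->
  (forall j, (j < N)%N -> 0 <= p.[pt j]) ->
  exists D, [/\ face C D, D (m t0) <-> p.[t0] = 0 &
    forall j, (j < N)%N -> D (m (pt j)) <-> p.[pt j] = 0].
Proof.
move=> sp p0 pj; have [i|D fD HD] := @poly_face _ _ t p sp.
  have : range t (t i) by exists i.
  by move=> /rangeE [->//|[j jN ->]]; exact: pj.
exists D; split=> // j jN.
by have [i _ <-] : range t (pt j) by apply/rangeE; right; exists j.
Qed.

Lemma face_param D : face C D -> exists p : {poly R},
  [/\ (size p <= 5)%N, D (m t0) <-> p.[t0] = 0,
    forall j, (j < N)%N -> 0 <= p.[pt j] &
    forall j, (j < N)%N -> D (m (pt j)) <-> p.[pt j] = 0].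
Proof.
move=> /face_poly[p [sp p0 Dp]]; exists p; split=> // j jN.
  by have [i _ <-] : range t (pt j) by apply/rangeE; right; exists j.
by have [i _ <-] : range t (pt j) by apply/rangeE; right; exists j.
Qed.

Lemma size_mul4 (p1 p2 p3 p4 : {poly R}) : (size p1 <= 2)%N -> (size p2 <= 2)%N ->
  (size p3 <= 2)%N -> (size p4 <= 2)%N -> (size (p1 * p2 * p3 * p4)%R <= 5)%N.
Proof.
move=> h1 h2 h3 h4; have := size_polyMleq (p1 * p2 * p3) p4.
have := size_polyMleq (p1 * p2) p3; have := size_polyMleq p1 p2; lia.
Qed.

(** The factor s - a pulled back along s = -1 / (t - t0), up to sign and the denominator s. *)
Definition grid_lin (a : R) : {poly R} := (-1)%:P - a *: ('X - t0%:P).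

Lemma size_grid_lin a : (size (grid_lin a) <= 2)%N.
Proof.
apply: (leq_trans (size_polyD _ _)); rewrite geq_max size_polyN.
rewrite (leq_trans (size_polyC_leq1 _)) //.
by rewrite (leq_trans (size_scale_leq _ _)) // size_XsubC.
Qed.

Lemma grid_lin0 a : (grid_lin a).[t0] = -1.
Proof. by rewrite !hornerE subrr mulr0 subr0. Qed.

Lemma grid_linE a j : (j < N)%N -> (grid_lin a).[pt j] = - (s j - a) / s j.
Proof. by move=> /s0 sj; rewrite !hornerE; field. Qed.

(** The factor ['X - t0%:P] puts t0 on the face and raises the denominator of the cubic to s ^ 4,
    which is positive, so signs on the grid carry over. *)
Lemma tight_face c i : (i <= N.-2)%N -> exists D, [/\ face C D, D (m t0) &
  forall j, (j < N)%N -> D (m (pt j)) <-> tight N c i j].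
Proof.
move=> iN; have N4 : (4 <= N)%N by lia.
have [ka [a [b [d H]]]] := gale_cubic smono c N4 iN.
have pE j : (j < N)%N -> (ka *: ('X - t0%:P) * grid_lin a * grid_lin b * grid_lin d).[pt j]
    = ka * ((s j - a) * (s j - b) * (s j - d)) / s j ^+ 4.
  move=> jN; rewrite !hornerM !grid_linE // hornerZ hornerXsubC; have := s0 jN => sj.
  by field.
have [|||D [fD D0 Dj]] := @param_face (ka *: ('X - t0%:P) * grid_lin a * grid_lin b * grid_lin d).
- apply: size_mul4; rewrite ?size_grid_lin //.
  by rewrite (leq_trans (size_scale_leq _ _)) // size_XsubC.
- by rewrite !hornerE subrr mulr0 !mul0r.
- by move=> j jN; rewrite pE // divr_ge0 ?(H j jN).1 // exprn_even_ge0.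
exists D; split=> //.
  by apply/D0; rewrite !hornerE subrr mulr0 !mul0r.
move=> j jN; apply: iff_trans (Dj j jN) _; rewrite pE //.
rewrite -(H j jN).2; split=> [/eqP|->]; last by rewrite mul0r.
by rewrite mulf_eq0 invr_eq0 expf_eq0 /= (negPf (s0 jN)) orbF => /eqP.
Qed.

(** Two adjacent pairs of roots use up degree 4, and the four factors multiply to 1 at t0. These
    faces supply the vertices of P off the facet. *)
Lemma far_face i : (i + 3 < N)%N -> exists D, [/\ face C D, ~ D (m t0) &
  forall j, (j < N)%N -> D (m (pt j)) <-> (i <= j <= i + 3)%N].
Proof.
move=> iN.
have pE j : (j < N)%N -> (grid_lin (s i) * grid_lin (s i.+1) *
    grid_lin (s i.+2) * grid_lin (s i.+3)).[pt j] =
    ((s j - s i) * (s j - s i.+1)) * ((s j - s i.+2) * (s j - s i.+3)) / s j ^+ 4.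
  by move=> jN; rewrite !hornerM !grid_linE //; have := s0 jN => sj; field.
have [|||D [fD D0 Dj]] := @param_face (grid_lin (s i) * grid_lin (s i.+1) *
    grid_lin (s i.+2) * grid_lin (s i.+3)).
- by apply: size_mul4; exact: size_grid_lin.
- by rewrite !hornerM !grid_lin0; lra.
- move=> j jN; rewrite pE // divr_ge0 ?exprn_even_ge0 // mulr_ge0 //.
    by apply: (grid_gap smono) => //; lia.
  by apply: (grid_gap smono) => //; lia.
exists D; split=> //.
  by move=> /D0; rewrite !hornerM !grid_lin0; lra.
move=> j jN; apply: iff_trans (Dj j jN) _; rewrite pE //.
apply: iff_trans (rwP eqP) _.
rewrite mulf_eq0 invr_eq0 expf_eq0 /= (negPf (s0 jN)) orbF.
by rewrite !mulf_eq0 !subr_eq0 !(grid_eq smono); lia.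
Qed.

Lemma pt_inj i j : (i < N)%N -> (j < N)%N -> pt i = pt j -> i = j.
Proof.
move=> iN jN /addrI/oppr_inj/invr_inj/eqP; rewrite (grid_eq smono) //.
by move/eqP.
Qed.

Lemma pt_neq j : (j < N)%N -> pt j != t0.
Proof.
move=> jN; rewrite -subr_eq0; have -> : pt j - t0 = - (s j)^-1 by ring.
by rewrite oppr_eq0 invr_eq0 s0.
Qed.

(** The polynomial of D has the root t0. For any two further roots the cofactor is linear, and
    multiplying by s ^ 4 turns it into a linear factor in s, as [gale_evenness] requires. *)
Lemma link_face D : face C D -> D (m t0) -> (forall j, (j < N)%N -> D (m (pt j))) \/
  exists c i, (i <= N.-2)%N /\ forall j, (j < N)%N -> D (m (pt j)) -> tight N c i j.
Proof.
move=> /face_param[p [sp D0 p0 Dp]] /D0 pt0; have N4 : (4 <= N)%N by lia.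
have [|x y /andP[xy yN] /eqP Zx /eqP Zy|all|[c [i [iN T]]]] :=
    @gale_evenness _ N s smono (fun j => p.[pt j] == 0).
- by [].
- have xN := ltn_trans xy yN; have sx := s0 xN; have sy := s0 yN.
  have sxy : s y - s x != 0 by rewrite subr_eq0 gt_eqF // smono ?xy.
  have [||q eq] := @uniq_roots_prod_XsubC _ p [:: t0; pt x; pt y].
  + by rewrite /= /root pt0 Zx Zy eqxx.
  + rewrite uniq_rootsE /= !inE negb_or ![t0 == _]eq_sym !pt_neq //= andbT.
    by apply/eqP => /pt_inj e; move: xy; rewrite e // ltnn.
  have sq : (size q <= 2)%N.
    have [->|q0] := eqVneq q 0; first by rewrite size_poly0.
    have : (size p = size q + 3)%N.
      rewrite eq size_Mmonic ?monic_prod_XsubC // size_prod_XsubC /=.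
      by rewrite addnS.
    by move=> e; move: sp; rewrite e; lia.
  have qE z : q.[z] = q`_0 + q`_1 * z.
    by rewrite (horner_coef_wide z sq) !big_ord_recl big_ord0 /= expr0 expr1 mulr1 addr0.
  exists (- (q`_0 + q`_1 * t0) / (s x * s y)), (q`_1 / (s x * s y)) => j jN.
  have sj := s0 jN.
  have e : (s j - s x) * (s j - s y) * (- (q`_0 + q`_1 * t0) / (s x * s y) * s j + q`_1 / (s x * s y))
      = s j ^+ 4 * p.[pt j].
    rewrite eq !big_cons big_nil mulr1 !hornerM !hornerXsubC qE.
    by field; rewrite sx sy sj.
  rewrite e; split; first by rewrite mulr_ge0 ?p0 // exprn_even_ge0.
  by rewrite mulf_eq0 expf_eq0 /= (negPf sj).
- by left=> j jN; apply/Dp => //; apply/eqP; exact: all.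
- by right; exists c, i; split=> // j jN /(Dp j jN)/eqP; exact: T.
Qed.


Lemma tight_face_coatom c i D : (i <= N.-2)%N -> face C D -> D (m t0) ->
  (forall j, (j < N)%N -> D (m (pt j)) <-> tight N c i j) ->
  D <> C /\ forall G, face C G -> D `<=` G -> G = D \/ G = C.
Proof.
move=> iN fD D0 DT; have N4 : (4 <= N)%N by lia.
split.
  have [j jN nt] : exists2 j, (j < N)%N & ~~ tight N c i j.
    (* Neither 4 nor 1 is an end of the grid; for i < 3 the pair i, i + 1 misses 4, and for i >= 3
       it misses 1. *)
    case: (ltnP i 3) => i3; [exists 4%N; first by lia|exists 1%N; first by lia].
      by rewrite /tight; lia.
    by rewrite /tight; lia.
  move=> e; case/negP: nt; apply/(DT j jN); rewrite e; apply: sub_convex_hull.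
  have [i' _ <-] : range t (pt j) by apply/rangeE; right; exists j.
  by exists i'.
have [J [W [JN _ _ TJ WJ]]] := tight_simple c N4 iN.
have Jinj : injective J.
  by move=> l l' e; apply/eqP; apply: contraTT (TJ l) => ne; move: (WJ l l');
    rewrite -e WJ eqxx ne.
apply: (@face_coatom _ _ t D (t0 :: [seq pt (J l) | l : 'I_3])) => //.
- rewrite /= map_inj_in_uniq ?enum_uniq ?andbT.
    by apply/mapP => -[l _ e]; have := pt_neq (JN l); rewrite -e eqxx.
  by move=> l l' _ _ /pt_inj-/(_ (JN l) (JN l'))/Jinj.
- by rewrite /= size_map -cardE card_ord.
- move=> x; rewrite inE => /orP[/eqP->|/mapP[l _ ->]]; first by exists i0.
  have [i' _ e] : range t (pt (J l)) by apply/rangeE; right; exists (J l).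
  by exists i' => //; rewrite e; apply/DT.
Qed.

Lemma far_face_coatom i D : (i + 3 < N)%N -> face C D -> ~ D (m t0) ->
  (forall j, (j < N)%N -> D (m (pt j)) <-> (i <= j <= i + 3)%N) ->
  D <> C /\ forall G, face C G -> D `<=` G -> G = D \/ G = C.
Proof.
move=> iN fD D0 DT; split.
  by move=> e; apply: D0; rewrite e; apply: sub_convex_hull; exists i0.
apply: (@face_coatom _ _ t D [seq pt (i + l) | l : 'I_4]) => //.
- rewrite map_inj_in_uniq ?enum_uniq // => l l' _ _ /pt_inj;
  move: (ltn_ord l) (ltn_ord l') => l4 l4'.
  have iN1 : (i + l < N)%N by lia.
  have iN2 : (i + l' < N)%N by lia.
  by move=> /(_ iN1 iN2)/addnI/val_inj.
- by rewrite size_map -cardE card_ord.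
- move=> x /mapP[l _ ->]; have l4 := ltn_ord l; have lN : (i + l < N)%N by lia.
  have [i' _ e] : range t (pt (i + l)) by apply/rangeE; right; exists (i + l)%N.
  by exists i' => //; rewrite e; apply/DT => //; lia.
Qed.

End CyclicLink.

(** * The obstruction *)

Section Wedge.
Context {R : realType} {n : nat} (P : set 'rV[R]_n) (N : nat).
Context (h : nat -> 'rV[R]_n * R) (hF : 'rV[R]_n * R).
Context (Z : bool -> nat -> 'rV[R]_n) (V V' : 'rV[R]_n).
Context (dimP : has_dim P 4) (N7 : (7 <= N)%N).
Context (PZ : forall c i, (i <= N.-2)%N -> P (Z c i)) (PV : P V) (PV' : P V').
Context (h_ge0 : forall j p, (j < N)%N -> P p -> 0 <= slack (h j) p).
Context (hZ : forall c i j, (i <= N.-2)%N -> (j < N)%N ->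
  slack (h j) (Z c i) = 0 <-> tight N c i j).
Context (hFZ : forall c i, (i <= N.-2)%N -> slack hF (Z c i) = 0).
Context (hFV : 0 < slack hF V) (hFV' : 0 < slack hF V').
Context (hV : forall j, (j < N)%N -> slack (h j) V = 0 <-> (1 <= j <= 4)%N).
Context (hV' : forall j, (j < N)%N -> slack (h j) V' = 0 <-> (2 <= j <= 5)%N).
Context (o : 'rV[R]_n) (r : R).
Context (sph : forall c i, (i <= N.-2)%N -> dot (Z c i - o) (Z c i - o) = r).

Let x := Z true 0%N.
Let y := Z true N.-2.

Lemma tight_slack0 c i j : (i <= N.-2)%N -> (j < N)%N -> tight N c i j ->
  slack (h j) (Z c i) = 0.
Proof. by move=> iN jN; exact: (hZ c iN jN).2. Qed.

Lemma tight_slack_gt0 c i j : (i <= N.-2)%N -> (j < N)%N -> ~~ tight N c i j ->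
  0 < slack (h j) (Z c i).
Proof.
move=> iN jN nt; rewrite lt_neqAle (h_ge0 jN (PZ c iN)) andbT eq_sym.
by apply: contra nt => /eqP /(hZ c iN jN).1.
Qed.

Let lt1 : (1 < N)%N. Proof. by lia. Qed.
Let ltN : (N.-1 < N)%N. Proof. by lia. Qed.
Let lt0 : (0 < N)%N. Proof. by lia. Qed.
Let le1 : (1 <= N.-2)%N. Proof. by lia. Qed.

(* The facet containing all the vertices Z c i. *)
Let base (c : bool) := if c then N.-1 else 0%N.

Let base_lt c : (base c < N)%N. Proof. by case: c. Qed.

Let base_x c : slack (h (base c)) x = 0.
Proof. by apply: tight_slack0 => //; rewrite /tight /base; case: c; lia. Qed.

Let base_y c : slack (h (base c)) y = 0.
Proof. by apply: tight_slack0 => //; rewrite /tight /base; case: c; lia. Qed.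

Let base_own c i : (i <= N.-2)%N -> slack (h (base c)) (Z c i) = 0.
Proof. by move=> iN; apply: tight_slack0 => //; rewrite /tight /base; case: c; lia. Qed.

Let base_other c i : (1 <= i < N.-2)%N -> 0 < slack (h (base (~~ c))) (Z c i).
Proof.
by move=> iN; apply: tight_slack_gt0 => //; rewrite /tight /base; case: c => /=; lia.
Qed.

Let h1x : slack (h 1) x = 0.
Proof. by apply: tight_slack0 => //; rewrite /tight; lia. Qed.

Let h1y : 0 < slack (h 1) y.
Proof. by apply: tight_slack_gt0 => //; rewrite /tight; lia. Qed.

Let range1 : (1 <= 1 < N.-2)%N. Proof. by lia. Qed.

(** Three edges of F leave x, towards y and the first vertices of the two circles; V adds the
    direction off F. The facet 1, the facets of the two circles and F form the triangular system for
    [affine_span]. *)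
Lemma wedge_span p : P p -> exists w0 w1 w2 w3 w4 : R,
  [/\ w0 + w1 + w2 + w3 + w4 = 1,
      p = w0 *: x + w1 *: y + w2 *: Z false 1 + w3 *: Z true 1 + w4 *: V &
      forall g, slack g p = w0 * slack g x + w1 * slack g y +
        w2 * slack g (Z false 1) + w3 * slack g (Z true 1) + w4 * slack g V].
Proof.
move=> Pp.
pose z (i : 'I_5) := nth V [:: x; y; Z false 1; Z true 1; V] i.
pose hh (i : 'I_4) := nth hF [:: h 1; h (base true); h (base false); hF] i.
have [w w1 ->] : exists2 w : 'I_5 -> R, \sum_i w i = 1 & p = \sum_i w i *: z i.
  apply: (@affine_span R n P 4 z hh dimP) => //.
  - by move=> [[|[|[|[|[|i]]]]] Hi] //=; apply: PZ.
  - move=> [[|[|[|[|i]]]] Hi] [[|[|[|[|[|j]]]]] Hj] //= _;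
      by [apply: hFZ|apply: base_own|apply: base_x|apply: base_y].
  - move=> [[|[|[|[|i]]]] Hi] //=; rewrite gt_eqF //.
      by apply: (base_other false range1).
    by apply: (base_other true range1).
exists (w ord0), (w (lift ord0 ord0)), (w (lift ord0 (lift ord0 ord0))),
  (w (lift ord0 (lift ord0 (lift ord0 ord0)))),
  (w (lift ord0 (lift ord0 (lift ord0 (lift ord0 ord0))))).
split=> [||g]; first by rewrite -w1 !big_ord_recl !big_ord0; ring.
  by rewrite !big_ord_recl !big_ord0 /z /= !addrA addr0.
by rewrite slack_sum // !big_ord_recl !big_ord0 /z /= !addrA addr0.
Qed.

(** The coefficients of [circle_param] on the circle c, based at its vertex 1; [U c g] is the linear
    one. *)
Let T c := dot (Z c 1 - x) (Z c 1 - x) / dot (Z c 1 - y) (Z c 1 - y).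
Let K c := dot (x - y) (x - y) / dot (Z c 1 - y) (Z c 1 - y).
Let U c g := slack g x + T c * slack g y - K c * slack g (Z c 1).

(** Lying on F removes the coordinate of V, and lying on the facet of the circle c removes that of
    the other circle. The facet of the other circle then measures [mu]. *)
Lemma wedge_side c p : P p -> slack hF p = 0 -> slack (h (base c)) p = 0 ->
  exists xi mu, p = y + xi *: (x - y) + mu *: (Z c 1 - y) /\
    slack (h (base (~~ c))) p = mu * slack (h (base (~~ c))) (Z c 1).
Proof.
move=> Pp Fp hp; have [w0 [w1 [w2 [w3 [w4 [w1E pE gE]]]]]] := wedge_span Pp.
have w40 : w4 = 0.
  move: Fp; rewrite gE !hFZ // !mulr0 !add0r.
  by move/eqP; rewrite mulf_eq0 (gt_eqF hFV) orbF => /eqP.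
have := gE (h (base (~~ c))); have := gE (h (base c)).
rewrite !base_x !base_y hp w40 !mul0r !mulr0 !add0r !addr0.
have b0 := base_own c le1; have b1 := base_other c range1.
have b0' := base_own (~~ c) le1; have := base_other (~~ c) range1.
rewrite negbK => b1'.
have y' : w1 = 1 - w0 - w2 - w3 by lra.
case: c b0 b1 b0' b1' {hp} => /= -> b1 -> b1'; rewrite !mulr0 ?addr0 ?add0r.
  move/esym/eqP; rewrite mulf_eq0 (gt_eqF b1') orbF => /eqP w20 e.
  exists w0, w3; split=> //; rewrite pE y' w20 w40.
  by rewrite !scalerBr !scalerBl scale1r !scale0r; apply/rowP => i; rewrite !mxE; ring.
move/esym/eqP; rewrite mulf_eq0 (gt_eqF b1') orbF => /eqP w20 e.
exists w0, w2; split=> //; rewrite pE y' w20 w40.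
by rewrite !scalerBr !scalerBl scale1r !scale0r; apply/rowP => i; rewrite !mxE; ring.
Qed.

Let Zy c i : (1 <= i < N.-2)%N -> Z c i != y.
Proof.
move=> iN; apply/eqP => e; have := base_other c iN.
by rewrite e base_y ltxx.
Qed.

Lemma wedge_param c i : (1 <= i < N.-2)%N -> exists tau w : R,
  [/\ 0 < tau, 0 < w, i = 1 -> tau = 1 & forall g, w * slack g (Z c i) =
    slack g x - tau * U c g + T c * tau ^+ 2 * slack g y].
Proof.
move=> iN; have iN' : (i <= N.-2)%N by lia.
have [xi [mu [pE bE]]] := wedge_side (PZ c iN') (hFZ c iN') (base_own c iN').
(* All inner vertices of one circle lie strictly on the same side of the facet carrying the
   other. *)
have mu0 : 0 < mu.
  by rewrite -(pmulr_lgt0 _ (base_other c range1)) -bE base_other.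
have F0 : 0 < dot (Z c 1 - y) (Z c 1 - y).
  by rewrite lt_neqAle dot_ge0 andbT eq_sym dot_eq0 subr_eq0 Zy.
have F'0 : 0 < dot (Z c i - y) (Z c i - y).
  by rewrite lt_neqAle dot_ge0 andbT eq_sym dot_eq0 subr_eq0 Zy.
have E0 : 0 < dot (x - y) (x - y).
  rewrite lt_neqAle dot_ge0 andbT eq_sym dot_eq0 subr_eq0; apply/eqP => e.
  by have := h1y; rewrite -e h1x ltxx.
have S p : p = x \/ p = y \/ p = Z c 1 \/ p = Z c i -> dot (p - o) (p - o) = r.
  by move=> [->|[->|[->|->]]]; apply: sph.
exists (mu * dot (Z c 1 - y) (Z c 1 - y) / dot (Z c i - y) (Z c i - y)),
  (dot (x - y) (x - y) / dot (Z c i - y) (Z c i - y)); split.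
- by rewrite divr_gt0 // mulr_gt0.
- by rewrite divr_gt0.
- move=> i1; move: bE; rewrite i1 => /eqP.
  rewrite -subr_eq0 -{1}[slack _ _]mul1r -mulrBl mulf_eq0 (gt_eqF (base_other c range1)).
  by rewrite orbF subr_eq0 => /eqP <-; rewrite mul1r divff // gt_eqF.
- move=> g; exact: (circle_param S pE (Zy c range1) (Zy c iN)).
Qed.

Let tight_core c i j : (1 <= i <= 4)%N -> (1 <= j <= 5)%N ->
  tight N c i j = (i == j) || (i.+1 == j).
Proof. by rewrite /tight; lia. Qed.

Let le4 i : (1 <= i <= 4)%N -> (i <= N.-2)%N.
Proof. by lia. Qed.

Let lt5 j : (1 <= j <= 5)%N -> (j < N)%N.
Proof. by lia. Qed.

Let h5x : 0 < slack (h 5) x.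
Proof. by apply: tight_slack_gt0; rewrite ?lt5 // /tight; lia. Qed.

Let hy j : (1 <= j <= 4)%N -> 0 < slack (h j) y.
Proof. by move=> j4; apply: tight_slack_gt0; rewrite ?/tight; lia. Qed.

Lemma wedge_not_inscribed : False.
Proof.
have r4 i : (1 <= i <= 4)%N -> (1 <= i < N.-2)%N by lia.
have mk c : exists t w : nat -> R, forall i, (1 <= i <= 4)%N ->
    [/\ 0 < t i, 0 < w i, i = 1%N -> t i = 1 & forall g, w i * slack g (Z c i) =
    slack g x - t i * U c g + T c * t i ^+ 2 * slack g y].
  have /choice[t /choice[w H]] : forall i, exists tau w : R, (1 <= i <= 4)%N ->
    [/\ 0 < tau, 0 < w, i = 1%N -> tau = 1 & forall g, w * slack g (Z c i) =
    slack g x - tau * U c g + T c * tau ^+ 2 * slack g y].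
    move=> i; case: (boolP (1 <= i <= 4)%N) => [/r4/(wedge_param c)[tau [w H]]|_];
      last by exists 0, 0.
    by exists tau, w.
  by exists t, w.
have [ta [wa Ha]] := mk false; have [tb [wb Hb]] := mk true.
have [w0 [w1 [w2 [w3 [w4 [w1E pE gE]]]]]] := wedge_span PV'.
have hF4 : slack hF V' = w4 * slack hF V.
  by rewrite gE !hFZ // !mulr0 !add0r.
pose q g := slack hF V' * slack g V - slack hF V * slack g V'.
have E0 : 0 < dot (x - y) (x - y).
  rewrite lt_neqAle dot_ge0 andbT eq_sym dot_eq0 subr_eq0; apply/eqP => e.
  by have := h1y; rewrite -e h1x ltxx.
have K0 c : 0 < K c.
  rewrite divr_gt0 // lt_neqAle dot_ge0 andbT eq_sym dot_eq0 subr_eq0.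
  exact: Zy range1.
have T0 c : 0 < T c.
  rewrite divr_gt0 // lt_neqAle dot_ge0 andbT eq_sym dot_eq0 subr_eq0;
    last exact: Zy range1.
  apply/eqP => e; have := base_other c range1.
  by rewrite e base_x ltxx.
have q_lt0 : q (h 1) < 0.
  rewrite /q (hV lt1).2 // mulr0 sub0r oppr_lt0 mulr_gt0 //.
  by rewrite lt_neqAle (h_ge0 lt1 PV') andbT eq_sym; apply/eqP => /(hV' lt1).1.
have lt5' : (5 < N)%N by exact: lt5.
have q_gt0 : 0 < q (h 5).
  rewrite /q (hV' lt5').2 // mulr0 subr0 mulr_gt0 //.
  by rewrite lt_neqAle (h_ge0 lt5' PV) andbT eq_sym; apply/eqP => /(hV lt5').1.
have q_eq0 j : (2 <= j <= 4)%N -> q (h j) = 0.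
  move=> j24; have /andP[j2 j4] := j24.
  have jN : (j < N)%N by rewrite lt5 // (ltnW j2) (leq_trans j4).
  have e1 : slack (h j) V = 0 by apply/(hV jN); rewrite (ltnW j2).
  have e2 : slack (h j) V' = 0 by apply/(hV' jN); rewrite j2 (leq_trans j4).
  by rewrite /q e1 e2 !mulr0 subr0.
(* In q the V-coordinate of V' cancels; writing [slack g (Z c 1)] through [U c g], x and y gives
   these coefficients. *)
pose A := - slack hF V * (w0 + w2 / K false + w3 / K true).
pose B := - slack hF V * (w1 + w2 * T false / K false + w3 * T true / K true).
pose C := slack hF V * w2 / K false.
pose D := slack hF V * w3 / K true.
have qE g : q g = A * slack g x + B * slack g y + C * U false g + D * U true g.
  rewrite /q hF4 (gE g) /A /B /C /D /U; field.
  by rewrite !gt_eqF.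
have [ta1 _ /(_ erefl) ta1E _] := Ha 1%N isT.
have [tb1 _ /(_ erefl) tb1E _] := Hb 1%N isT.
have eta (f : nat -> R) i : (1 <= i <= 4)%N -> f 1%N = 1 ->
    nth 0 [:: 0; 1; f 2; f 3; f 4] i = f i.
  by case: i => [|[|[|[|[|i]]]]].
apply: (@no_alternating_wedge R (T false) (T true) (ta 2) (ta 3) (ta 4)
  (tb 2) (tb 3) (tb 4) (fun j => slack (h j) x) (fun j => slack (h j) y)
  (fun j => U false (h j)) (fun j => U true (h j)) A B C D) => //.
- by move=> i i14; rewrite !eta //; have [? _ _ _] := Ha i i14;
  have [? _ _ _] := Hb i i14.
- by apply: h_ge0 => //; exact: PZ.
- move=> i j i14 j15; rewrite !eta //=.
  have [_ pa _ <-] := Ha i i14; have [_ pb _ <-] := Hb i i14.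
  have iN := le4 i14; have jN := lt5 j15; rewrite -(tight_core false) //.
  have tc c : tight N c i j = tight N false i j by rewrite !tight_core.
  case: ifPn => ij.
    by rewrite !(tight_slack0 iN jN) ?tc ?mulr0.
  by split; rewrite mulr_gt0 // (tight_slack_gt0 iN jN) ?tc.
- by rewrite -qE.
- by rewrite -qE.
- by move=> j j24; rewrite -qE q_eq0.
Qed.
End Wedge.

(** * Duality *)

Section Duality.
Context {R : realType} {n d : nat} (P : set 'rV[R]_n) (C : set 'rV[R]_d).
Context (f : set 'rV[R]_n -> set 'rV[R]_d).
Context (polP : polytope P) (bij : set_bij (face P) (face C) f).
Context (anti : forall F G, face P F -> face P G -> (F `<=` G <-> f G `<=` f F)).

Lemma dual_face F : face P F -> face C (f F).
Proof. by case: bij => H _ _; exact: H. Qed.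

Lemma dual_surj D : face C D -> exists2 F, face P F & f F = D.
Proof. by case: bij => _ _ H /H[F fF <-]; exists F. Qed.

Lemma dual_inj F G : face P F -> face P G -> f F = f G -> F = G.
Proof.
move=> fF fG e; apply/seteqP; split.
  by apply/(anti fF fG); rewrite e.
by apply/(anti fG fF); rewrite e.
Qed.

Lemma dual_self : f P = set0.
Proof.
have [F fF e] := dual_surj (face_set0 C).
apply/seteqP; split=> //; rewrite -e.
by apply/(anti fF (face_self P)); exact: face_sub.
Qed.

Lemma dual_set0 : f set0 = C.
Proof.
apply/seteqP; split; first exact: face_sub (dual_face (face_set0 P)).
have [F fF e] := dual_surj (face_self C); rewrite -{1}e.
by apply/(anti (face_set0 P) fF).
Qed.

(** The face of P dual to D is nonempty, hence contains a vertex, and maximality of D makes it equal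
    to that vertex. *)
Lemma dual_coatom D : face C D -> D <> C ->
  (forall G, face C G -> D `<=` G -> G = D \/ G = C) ->
  exists2 v, vertex P v & f [set v] = D.
Proof.
move=> fD DC max; have [F fF e] := dual_surj fD.
have F0 : F !=set0.
  apply: contrapT => /nonemptyPn F0; apply: DC.
  by rewrite -e F0 dual_set0.
have [v vv Fv] := face_vertex polP fF F0; exists v => //.
have vF : [set v] `<=` F by move=> _ ->.
have := (anti vv fF).1 vF; rewrite e => /(max _ (dual_face vv))[//|e0].
have : [set v] = set0 by apply: dual_inj => //; [exact: face_set0|rewrite e0 dual_set0].
by move=> /seteqP[/(_ v erefl)].
Qed.

(** Order reversal turns the maximality in [facet_max] into minimality among nonempty faces. *)
Lemma dual_facet F : facet P F ->
  f F !=set0 /\ forall D, face C D -> D `<=` f F -> D !=set0 -> D = f F.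
Proof.
move=> facF; have fF : face P F by case: facF.
have [F0 FP Fmax] := facet_max facF; split.
  apply: contrapT => /nonemptyPn e; apply: FP; apply: dual_inj => //.
    exact: face_self.
  by rewrite e dual_self.
move=> D fD DF D0; have [G fG e] := dual_surj fD.
have FG : F `<=` G by apply/(anti fF fG); rewrite e.
have [GF|GP] := Fmax G fG FG; first by rewrite -e GF.
by case: D0; rewrite -e GP dual_self => v [].
Qed.

End Duality.

Section DualCyclic.
Context {R : realType} {n k : nat} (P : set 'rV[R]_n) (t : 'I_k -> R).
Local Notation m := (moment_curve 4).
Local Notation C := (cyclic_polytope t : set 'rV[R]_4).
Context (f : set 'rV[R]_n -> set 'rV[R]_4).
Context (polP : polytope P) (bij : set_bij (face P) (face C) f).
Context (anti : forall F G, face P F -> face P G -> (F `<=` G <-> f G `<=` f F)).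

Lemma facet_dual_vertex F : facet P F -> exists i, f F = [set m (t i)].
Proof.
move=> facF; have [F0 Fmin] := dual_facet bij anti facF.
have fF : face P F by case: facF.
have [i Fi] := nonempty_face (dual_face bij fF) F0.
exists i; symmetry; apply: Fmin; first exact: vertex_face.
  by move=> _ ->.
by exists (m (t i)).
Qed.

Context (tinj : injective t) (k8 : (8 <= k)%N) (dimP : has_dim P 4).

Lemma facet_not_inscribed F : facet P F -> ~ inscribed F.
Proof.
move=> facF [o [r [_ sph]]]; have [i0 fFE] := facet_dual_vertex facF.
have fF : face P F by case: facF.
have [s [s0 smono rangeE]] := reparametrization i0 tinj.
have N7 : (7 <= k.-1)%N by lia.
pose pt j := t i0 - (s j)^-1.
have ptv j : (j < k.-1)%N -> face C [set m (pt j)].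
  move=> jN; have [i _ <-] : range t (pt j) by apply/rangeE; right; exists j.
  exact: vertex_face.
have /choice[h hP] : forall j, exists h : 'rV[R]_n * R, (j < k.-1)%N ->
    [/\ forall p, P p -> 0 <= slack h p, face P (zeros P h) & f (zeros P h) = [set m (pt j)]].
  move=> j; case: (boolP (j < k.-1)%N) => [jN|_]; last by exists 0.
  have [G fG e] := dual_surj bij (ptv j jN).
  by case/faceP: (fG) => h h0 eG; exists h => _; rewrite -eG.
have zerosP j p D : (j < k.-1)%N -> vertex P p -> f [set p] = D ->
    slack (h j) p = 0 <-> D (m (pt j)).
  move=> jN vp eD; have [_ fh eh] := hP j jN; have Pp : P p by apply: (face_sub vp).
  have := anti vp fh; rewrite eh eD => -[H1 H2]; split=> [hp|Dp].
    by apply: H1 => // _ ->.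
  by have [] : zeros P (h j) p by apply: H2 => // _ ->.
have Fp p D : vertex P p -> f [set p] = D -> F p <-> D (m (t i0)).
  move=> vp eD; have := anti vp fF; rewrite fFE eD => -[H1 H2]; split=> [hp|Dp].
    by apply: H1 => // _ ->.
  by apply: H2 => // _ ->.
have mkZ (c : bool) i : exists z, (i <= k.-1.-2)%N -> [/\ vertex P z, F z &
    forall j, (j < k.-1)%N -> slack (h j) z = 0 <-> tight k.-1 c i j].
  case: (boolP (i <= k.-1.-2)%N) => [iN|_]; last by exists 0.
  have [D [fD D0 DT]] := tight_face N7 s0 smono rangeE c iN.
  have [DC Dmax] := tight_face_coatom N7 s0 smono rangeE iN fD D0 DT.
  have [z vz ez] := dual_coatom polP bij anti fD DC Dmax.
  exists z => _; split=> //; first exact/(Fp z D).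
  by move=> j jN; apply: iff_trans (zerosP j z D jN vz ez) (DT j jN).
have /choice[Z1 HZ1] := mkZ true; have /choice[Z0 HZ0] := mkZ false.
pose Z (c : bool) := if c then Z1 else Z0.
have HZ c i : (i <= k.-1.-2)%N -> [/\ vertex P (Z c i), F (Z c i) &
    forall j, (j < k.-1)%N -> slack (h j) (Z c i) = 0 <-> tight k.-1 c i j].
  by case: c; [exact: HZ1|exact: HZ0].
have mkV i : (i + 3 < k.-1)%N -> exists v, [/\ P v, ~ F v &
    forall j, (j < k.-1)%N -> slack (h j) v = 0 <-> (i <= j <= i + 3)%N].
  move=> iN; have [D [fD D0 DT]] := far_face N7 s0 smono rangeE iN.
  have [DC Dmax] := far_face_coatom N7 smono rangeE iN fD D0 DT.
  have [z vz ez] := dual_coatom polP bij anti fD DC Dmax.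
  exists z; split; [exact: (face_sub vz)|by move/(Fp z D vz ez)|].
  by move=> j jN; apply: iff_trans (zerosP j z D jN vz ez) (DT j jN).
(* V and V' are the vertices {1,2,3,4} and {2,3,4,5}, adjacent in P and off F. *)
have [|V [PV FV hV]] := mkV 1%N; first by lia.
have [|V' [PV' FV' hV']] := mkV 2%N; first by lia.
case/faceP: (fF) => hF hF0 eF.
have nF v : P v -> ~ F v -> 0 < slack hF v.
  move=> Pv nFv; rewrite lt_neqAle hF0 // andbT eq_sym; apply/eqP => e.
  by apply: nFv; rewrite eF.
apply: (@wedge_not_inscribed R n P k.-1 h hF Z V V' dimP N7 _ PV PV' _ _ _
  (nF V PV FV) (nF V' PV' FV') hV hV' o (r ^+ 2)) => //.
- by move=> c i iN; have [/face_sub Pz _ _] := HZ c i iN; exact: Pz.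
- by move=> j p jN; have [H _ _] := hP j jN; exact: H.
- by move=> c i j iN; have [_ _] := HZ c i iN; exact.
- by move=> c i iN; have [_ + _] := HZ c i iN; rewrite eF => -[].
- move=> c i iN; have [vz Fz _] := HZ c i iN.
  have : vertex F (Z c i) by apply: (face_of_face fF vz) => _ ->.
  by move=> /sph; rewrite /sphere /= /enorm => <-; rewrite sqr_sqrtr ?dot_ge0.
Qed.

End DualCyclic.

(** * The inscribed wedge *)

Lemma slack_big {R : realType} {n m : nat} (T : pred 'I_m) (h : 'I_m -> 'rV[R]_n * R) x :
  slack (\sum_(j | T j) h j) x = \sum_(j | T j) slack (h j) x.
Proof.
apply: (big_ind2 (fun g a => slack g x = a)) => //.
  by rewrite /slack dotC dot0r subr0.
by move=> ? ? ? ? <- <-; rewrite slackD.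
Qed.

Lemma face_inter {R : realType} {n : nat} (P F G : set 'rV[R]_n) :
  face P F -> face P G -> face P (F `&` G).
Proof.
move=> /faceP[h h0 ->] /faceP[g g0 ->]; apply/faceP; exists (h + g).
  by move=> x Px; rewrite slackD addr_ge0 ?h0 ?g0.
apply/seteqP; split=> x.
  by move=> [[Px hx] [_ gx]]; split=> //; rewrite slackD hx gx addr0.
move=> [Px]; rewrite slackD => /eqP; rewrite paddr_eq0 ?h0 ?g0 //.
by move=> /andP[/eqP hx /eqP gx].
Qed.

Lemma has_dim_setT {R : realType} {n : nat} : has_dim [set: 'rV[R]_n] n.
Proof.
exists 0, fullv; split; last by rewrite dimvf /dim /= mul1n.
apply/seteqP; split=> x _; last exact: sub_affine_hull.
by exists x; [exact: memvf|rewrite add0r].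
Qed.

(** Both sides are affine in x and agree on the affine basis formed by [v0] and the [v i]. *)
Lemma affine_interpolation {R : realType} {n : nat} (v0 : 'rV[R]_n)
    (v : 'I_n -> 'rV[R]_n) (h : 'I_n -> 'rV[R]_n * R) (g : 'rV[R]_n * R) :
  (forall i, slack (h i) v0 = 0) ->
  (forall i j, (slack (h i) (v j) == 0) = (i != j)) -> slack g v0 = 0 ->
  forall x, slack g x = \sum_i slack g (v i) / slack (h i) (v i) * slack (h i) x.
Proof.
move=> h0 hv g0 x.
pose z i := if unlift ord0 i is Some j then v j else v0.
have z0 : z ord0 = v0 by rewrite /z unlift_none.
have zl i : z (lift ord0 i) = v i by rewrite /z liftK.
have [|||w w1 ->] := @affine_span R n [set: 'rV[R]_n] n z h has_dim_setT _ _ _ x I.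
- by [].
- move=> i j; case: (unliftP ord0 j) => [j' ->|->]; last by rewrite z0.
  rewrite zl => ji; apply/eqP; rewrite hv; apply: contraL ji => /eqP->.
  by rewrite /= /bump leq0n add1n ltnn.
- by move=> i; rewrite zl hv eqxx.
rewrite slack_sum // big_ord_recl z0 g0 mulr0 add0r; apply: eq_bigr => i _.
rewrite zl slack_sum // big_ord_recl z0 h0 mulr0 add0r (bigD1 i) //= big1.
  by rewrite zl addr0; field; rewrite hv eqxx.
move=> j ji; rewrite zl; have /eqP -> : slack (h i) (v j) == 0 by rewrite hv eq_sym.
by rewrite mulr0.
Qed.

Section InscribedWedge.
Context {R : realType} (N : nat) (N7 : (7 <= N)%N).

(* With (p : q) homogeneous coordinates on a projective line, the half-circles
   are (p : q) |-> (2pq, 0, q^2 - p^2) / (p^2 + q^2) and its mirror image; the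
   vertices are at (p : q) = (N - 2 - i : i). *)
Let al (i : nat) : R := (N.-2)%:R - i%:R.
Let be (i : nat) : R := i%:R.
Let den i := al i ^+ 2 + be i ^+ 2.

Definition wedge_vertex (c : bool) (i : nat) : 'rV[R]_3 :=
  \row_(l < 3) [:: if c then 0 else 2 * al i * be i / den i;
                   if c then 2 * al i * be i / den i else 0;
                   (be i ^+ 2 - al i ^+ 2) / den i]`_l.

Definition row3 (a b c : R) : 'rV[R]_3 := \row_(l < 3) [:: a; b; c]`_l.

Lemma dot_row3 a b c a' b' c' : dot (row3 a b c) (row3 a' b' c') = a * a' + b * b' + c * c'.
Proof. by rewrite /dot !big_ord_recl big_ord0 !mxE /= addr0 addrA. Qed.

(** The generic case is the equation of the chord joining the parameters j - 1 and j, which has the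
    same coefficient on both half-planes by mirror symmetry. *)
Definition wedge_facet (j : nat) : 'rV[R]_3 * R :=
  if j == 0%N then (row3 0 (-1) 0, 0)
  else if j == N.-1 then (row3 (-1) 0 0, 0)
  else let p := al j.-1 * be j + al j * be j.-1 in
    (row3 p p (be j.-1 * be j - al j.-1 * al j), be j.-1 * be j + al j.-1 * al j).

Lemma den_gt0 i : 0 < den i.
Proof.
rewrite lt_neqAle addr_ge0 ?sqr_ge0 // andbT eq_sym paddr_eq0 ?sqr_ge0 //.
rewrite !sqrf_eq0 /al /be; apply/negP => /andP[e /eqP b].
by move: e; rewrite b subr0 pnatr_eq0; lia.
Qed.

Lemma wedge_slack c i j : (i <= N.-2)%N -> (j < N)%N ->
  0 <= slack (wedge_facet j) (wedge_vertex c i) /\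
  (slack (wedge_facet j) (wedge_vertex c i) = 0 <-> tight N c i j).
Proof.
move=> iN jN; have d0 := den_gt0 i.
have ali : al i = (N.-2 - i)%:R by rewrite /al natrB.
have ab0 : 0 <= 2 * al i * be i / den i.
  apply: divr_ge0; last exact: ltW.
  by rewrite ali -!natrM ler0n.
have abE : (2 * al i * be i / den i == 0) = (i == 0%N) || (i == N.-2).
  rewrite !mulf_eq0 invr_eq0 (gt_eqF d0) orbF ali /be !pnatr_eq0; lia.
have dV := lt0r_neq0 d0.
rewrite /wedge_facet /tight -[wedge_vertex c i]/(row3 _ _ _).
case: (eqVneq j 0%N) => [j0|j0].
  rewrite /slack dot_row3 /=; case: c; last by split; [lra|split=> _; [|lra]].
  have -> : 0 - (0 * 0 + -1 * (2 * al i * be i / den i) +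
     0 * ((be i ^+ 2 - al i ^+ 2) / den i)) = 2 * al i * be i / den i by ring.
  by split=> //; apply: iff_trans (rwP eqP) _; rewrite abE; lia.
case: (eqVneq j N.-1) => [jN1|jN1].
  rewrite /slack dot_row3 /=; case: c; first by split; [lra|split=> _; [|lra]]; lia.
  have -> : 0 - (-1 * (2 * al i * be i / den i) + 0 * 0 +
     0 * ((be i ^+ 2 - al i ^+ 2) / den i)) = 2 * al i * be i / den i by ring.
  by split=> //; apply: iff_trans (rwP eqP) _; rewrite abE; lia.
have -> : slack (row3 (al j.-1 * be j + al j * be j.-1) (al j.-1 * be j + al j * be j.-1)
     (be j.-1 * be j - al j.-1 * al j), be j.-1 * be j + al j.-1 * al j)
   (row3 (if c then 0 else 2 * al i * be i / den i)
      (if c then 2 * al i * be i / den i else 0)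
      ((be i ^+ 2 - al i ^+ 2) / den i)) =
    2 * (N.-2)%:R ^+ 2 / den i * (((j.-1)%:R - i%:R) * (j%:R - i%:R)).
  rewrite /slack dot_row3 /=.
  transitivity (be j.-1 * be j + al j.-1 * al j - ((al j.-1 * be j + al j * be j.-1) *
    (2 * al i * be i / den i) + (be j.-1 * be j - al j.-1 * al j) * ((be i ^+ 2 - al i ^+ 2) / den i))).
    by case: c; ring.
  by rewrite /den /al /be in dV *; field.
have M0 : 0 < 2 * (N.-2)%:R ^+ 2 / den i :> R.
  by rewrite divr_gt0 // mulr_gt0 // exprn_gt0 // ltr0n; lia.
(* No integer i lies strictly between j - 1 and j, so the product of the two differences is
   nonnegative. *)
split.
  rewrite pmulr_rge0 //; case: (leqP j i) => ji.
    by rewrite mulr_le0 // subr_le0 ler_nat; lia.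
  by rewrite mulr_ge0 // subr_ge0 ler_nat; lia.
apply: iff_trans (rwP eqP) _;
  rewrite mulf_eq0 (gt_eqF M0) /= mulf_eq0 !subr_eq0 !eqr_nat; lia.
Qed.

Definition wedge_vertices : set 'rV[R]_3 :=
  range (fun p : bool * 'I_N.-1 => wedge_vertex p.1 p.2).

Definition wedge := convex_hull wedge_vertices.

Lemma wedge_polytope : polytope wedge.
Proof. by exists wedge_vertices => //; exact: finite_image. Qed.

Lemma wedge_verticesP v : wedge_vertices v <->
  exists c i, (i <= N.-2)%N /\ v = wedge_vertex c i.
Proof.
split=> [[[c i] _ <-]|[c [i [iN ->]]]].
  by exists c, i; split=> //; have := ltn_ord i; lia.
have iN' : (i < N.-1)%N by lia.
by exists (c, Ordinal iN').
Qed.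

Lemma wedge_facet_ge0 j x : (j < N)%N -> wedge x -> 0 <= slack (wedge_facet j) x.
Proof.
move=> jN; apply: slack_hull_ge0 => v /wedge_verticesP[c [i [iN ->]]].
exact: (wedge_slack c iN jN).1.
Qed.

Lemma wedge_inscribed : inscribed wedge.
Proof.
exists 0, 1; split.
  have i0 : wedge (wedge_vertex true 0).
    by apply/sub_convex_hull/wedge_verticesP; exists true, 0%N.
  have iM : wedge (wedge_vertex true N.-2).
    by apply/sub_convex_hull/wedge_verticesP; exists true, N.-2.
  (* x and y are antipodal, so the centre is their midpoint. *)
  exists 2%N, (fun l : 'I_2 => if l == ord0 then wedge_vertex true 0 else wedge_vertex true N.-2), (fun=> 2^-1).
  have M0 : (N.-2)%:R != 0 :> R by rewrite pnatr_eq0; lia.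
  split=> [l||]; first by case: ifP.
    by rewrite !big_ord_recl big_ord0; field.
  rewrite !big_ord_recl big_ord0 addr0 /=; apply/rowP => l; rewrite !mxE /den /al /be.
  by case: l => -[|[|[|l]]] Hl //=; rewrite ?subrr ?subr0; field.
move=> v /vertex_hull /wedge_verticesP[c [i [iN ->]]].
have d0 := lt0r_neq0 (den_gt0 i).
rewrite /sphere /= subr0 /enorm -[wedge_vertex c i]/(row3 _ _ _) dot_row3.
rewrite -[RHS]sqrtr1; congr Num.sqrt; rewrite /den in d0 *.
by case: c; field.
Qed.

Definition wedge_face (T : nat -> Prop) : set 'rV[R]_3 :=
  [set x | wedge x /\ forall j, (j < N)%N -> T j -> slack (wedge_facet j) x = 0].

Lemma wedge_face_face T : face wedge (wedge_face T).
Proof.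
apply/faceP; exists (\sum_(j < N | `[< T j >]) wedge_facet j).
  by move=> x Qx; rewrite slack_big sumr_ge0 // => j _; exact: wedge_facet_ge0.
apply/seteqP; split=> x [Qx H]; split=> //.
  by rewrite slack_big big1 // => j /asboolP; exact: H.
move=> j jN Tj; move: H; rewrite slack_big => /eqP.
rewrite psumr_eq0 => [/allP/(_ (Ordinal jN))|i _]; last exact: wedge_facet_ge0.
by rewrite mem_index_enum => /(_ isT) /implyP/(_ (asboolT Tj)) /eqP.
Qed.

Lemma wedge_vertex_in c i T : (i <= N.-2)%N ->
  wedge_face T (wedge_vertex c i) <-> forall j, (j < N)%N -> T j -> tight N c i j.
Proof.
move=> iN; split=> [[_ H] j jN Tj|H].
  exact/(wedge_slack c iN jN).2/H.
split; first by apply/sub_convex_hull/wedge_verticesP; exists c, i.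
by move=> j jN Tj; apply/(wedge_slack c iN jN).2/H.
Qed.

Lemma wedge_face_vertex E : face wedge E -> E !=set0 ->
  exists c i, (i <= N.-2)%N /\ E (wedge_vertex c i).
Proof.
move=> fE; rewrite {1}(face_hull fE) => /convex_hull0[v [/wedge_verticesP[c [i [iN ->]]] Ev]].
by exists c, i.
Qed.

(* At a vertex of E, a functional cutting out E is a combination of the three
   facet functionals vanishing there, and evaluating it at the three neighbours
   shows that the coefficients are nonnegative. *)
Lemma wedge_faceE E : face wedge E -> E !=set0 -> exists c i T,
  [/\ (i <= N.-2)%N, forall j, (j < N)%N -> T j -> tight N c i j & E = wedge_face T].
Proof.
move=> fE E0; have [c [i [iN Ei]]] := wedge_face_vertex fE E0.
have N4 : (4 <= N)%N by lia.
have [J [W [JN WN JT TJ WJ]]] := tight_simple c N4 iN.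
case/faceP: fE => g g0 eE.
have QW l : wedge (wedge_vertex (W l).1 (W l).2).
  by apply/sub_convex_hull/wedge_verticesP; exists (W l).1, (W l).2.
have hW i' j : (slack (wedge_facet (J i')) (wedge_vertex (W j).1 (W j).2) == 0) = (i' != j).
  have -> : (i' != j) = tight N (W j).1 (W j).2 (J i') by rewrite WJ eq_sym.
  have [_ [e1 e2]] := wedge_slack (W j).1 (WN j) (JN i').
  by apply/eqP/idP => [e|e]; [exact: e1|exact: e2].
have gi : slack g (wedge_vertex c i) = 0 by move: Ei; rewrite eE => -[].
have gE := @affine_interpolation R 3 (wedge_vertex c i)
  (fun l => wedge_vertex (W l).1 (W l).2) (fun l => wedge_facet (J l)) g
  (fun l => (wedge_slack c iN (JN l)).2.2 (TJ l)) hW gi.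
pose a l := slack g (wedge_vertex (W l).1 (W l).2) /
   slack (wedge_facet (J l)) (wedge_vertex (W l).1 (W l).2).
have a0 l : 0 <= a l by rewrite divr_ge0 ?g0 ?wedge_facet_ge0.
exists c, i, (fun j => exists2 l, j = J l & a l != 0); split=> //.
  by move=> j jN [l -> _].
rewrite eE; apply/seteqP; split=> x [Qx].
  rewrite gE => /eqP; rewrite psumr_eq0 => [/allP H|l _]; last first.
    by rewrite mulr_ge0 ?a0 // wedge_facet_ge0.
  split=> // j jN [l -> al0]; have := H l (mem_index_enum _).
  by rewrite mulf_eq0 (negPf al0) => /eqP.
move=> H; split=> //; rewrite gE big1 // => l _.
have [a00|al0] := eqVneq (a l) 0; first by rewrite -/(a l) a00 mul0r.
by rewrite H ?mulr0 //; exists l.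
Qed.

End InscribedWedge.

(** * Combinatorial equivalence of a facet with the inscribed wedge *)

Section FacetInscribable.
Context {R : realType} {n k : nat} (P : set 'rV[R]_n) (t : 'I_k -> R).
Local Notation m := (moment_curve 4).
Local Notation C := (cyclic_polytope t : set 'rV[R]_4).
Context (f : set 'rV[R]_n -> set 'rV[R]_4).
Context (polP : polytope P) (bij : set_bij (face P) (face C) f).
Context (anti : forall F G, face P F -> face P G -> (F `<=` G <-> f G `<=` f F)).
Context (tinj : injective t) (k8 : (8 <= k)%N).

(** The facets of the cyclic polytope are simplices: for each of the three [J l] outside T, the face
    is intersected with the one of the neighbour [W l], which drops exactly [J l]. *)
Lemma sub_tight_face i0 (s : nat -> R) c i (T : nat -> Prop) :
  (forall j, (j < k.-1)%N -> s j != 0) ->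
  (forall i j, (i < j < k.-1)%N -> s i < s j) ->
  (forall x, range t x <->
    x = t i0 \/ exists2 j, (j < k.-1)%N & x = t i0 - (s j)^-1) ->
  (i <= k.-1.-2)%N -> (forall j, (j < k.-1)%N -> T j -> tight k.-1 c i j) ->
  exists D, [/\ face C D, D (m (t i0)) &
    forall j, (j < k.-1)%N -> D (m (t i0 - (s j)^-1)) <-> T j].
Proof.
move=> s0 smono rangeE iN sub.
have N7 : (7 <= k.-1)%N by lia.
have N4 : (4 <= k.-1)%N by lia.
have [J [W [JN WN JT TJ WJ]]] := tight_simple c N4 iN.
have CC x : range t x -> C (m x).
  by move=> [i' _ <-]; apply: sub_convex_hull; exists i'.
have /choice[D HD] : forall l, exists D, [/\ face C D, D (m (t i0)) &
    forall j, (j < k.-1)%N -> tight k.-1 c i j ->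
      D (m (t i0 - (s j)^-1)) <-> (j = J l -> T j)].
  move=> l; case: (pselect (T (J l))) => Tl.
    exists C; split; [exact: face_self|by apply: CC; exists i0|].
    by move=> j jN _; split=> [_ ->//|_]; apply: CC; apply/rangeE; right; exists j.
  have [D [fD D0 DT]] := tight_face N7 s0 smono rangeE (W l).1 (WN l).
  exists D; split=> // j jN /(JT j jN)[l' ->].
  apply: iff_trans (DT _ (JN l')) _; rewrite WJ; split=> [ne e|H].
    by have := WJ l l; rewrite -e WJ ne eqxx.
  by apply/eqP => ll; apply: Tl; move: H; rewrite -ll; exact.
have [D0 [fD0 D00 DT0]] := tight_face N7 s0 smono rangeE c iN.
pose l0 := Ordinal (isT : (0 < 3)%N); pose l1 := Ordinal (isT : (1 < 3)%N).
pose l2 := Ordinal (isT : (2 < 3)%N).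
exists (D0 `&` (D l0 `&` (D l1 `&` D l2))); split.
- have fD l : face C (D l) by case: (HD l).
  by do 3!apply: face_inter => //.
- have Dt l : D l (m (t i0)) by case: (HD l).
  by split=> //; split=> //; split.
move=> j jN; split=> [[/(DT0 j jN) tj [D0j [D1j D2j]]]|Tj].
  have [l jl] := JT j jN tj.
  have : D l (m (t i0 - (s j)^-1)) by elim/ord3P: l {jl}.
  by have [_ _ H] := HD l => /(H j jN tj); apply.
have tj := sub j jN Tj.
have Dl l : D l (m (t i0 - (s j)^-1)) by have [_ _ H] := HD l; apply/(H j jN tj).
by split; [exact/(DT0 j jN)|].
Qed.

(** A face G of F is encoded by the set [T G] of the other facets of P containing it, read off from
    the vertices of its dual face; the wedge has the same incidences. *)
Lemma facet_inscribable F : facet P F -> inscribable F.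
Proof.
move=> facF; have [i0 fFE] := facet_dual_vertex bij anti facF.
have fF : face P F by case: facF.
have [s [s0 smono rangeE]] := reparametrization i0 tinj.
have N7 : (7 <= k.-1)%N by lia.
have N4 : (4 <= k.-1)%N by lia.
set N := k.-1 in s0 smono rangeE N7 N4.
pose pt j := t i0 - (s j)^-1.
have up G : face F G -> face P G by exact: face_trans.
have fin G : face F G -> f G (m (t i0)).
  move=> fG; have := (anti (up G fG) fF).1 (face_sub fG).
  by rewrite fFE; apply.
pose T G j := f G (m (pt j)).
have sub F' G' : face F F' -> face F G' ->
    (F' `<=` G') <-> (forall j, (j < N)%N -> T G' j -> T F' j).
  move=> fF' fG'; apply: iff_trans (anti (up _ fF') (up _ fG')) _.
  have fc := dual_face bij (up _ fF'); have gc := dual_face bij (up _ fG').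
  apply: iff_trans (cyclic_face_sub gc fc) _; split=> H.
    move=> j jN; have [i _ e] : range t (pt j) by apply/rangeE; right; exists j.
    by rewrite /T -e; exact: H.
  move=> i; have : range t (t i) by exists i.
  by move=> /rangeE[->|[j jN ->]]; [move=> _; exact: fin|exact: H].
exists 3, (wedge N); split; [exact: wedge_polytope| |exact: wedge_inscribed].
have mono F' G' : face F F' -> face F G' ->
    (F' `<=` G') <-> ((wedge_face N (T F') : set 'rV[R]_3) `<=` wedge_face N (T G')).
  move=> fF' fG'; apply: iff_trans (sub _ _ fF' fG') _; split.
    by move=> H x [Qx Hx]; split=> // j jN /(H j jN); exact: Hx.
  (* If j is missing from [T F'], a vertex of the wedge on all facets in [T F'], or its neighbour
     off facet j, lies on the first face but not on the second. *)
  move=> H j jN Tj; apply: contrapT => nTj.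
  have [all|[c [i [iN tF]]]] := link_face N7 s0 smono rangeE
      (dual_face bij (up _ fF')) (fin _ fF'); first by apply: nTj; exact: all.
  have absurd c' i' : (i' <= N.-2)%N ->
      (forall j', (j' < N)%N -> T F' j' -> tight N c' i' j') -> tight N c' i' j.
    move=> iN' sub'; have : wedge_face N (T F') (wedge_vertex N c' i' : 'rV[R]_3).
      exact: (wedge_vertex_in N7 c' (T F') iN').2 sub'.
    move=> Hw; apply: ((wedge_vertex_in N7 c' (T G') iN').1 (H _ Hw) j jN Tj).
  have tj := absurd c i iN tF.
  have [J [W [JN WN JT TJ WJ]]] := tight_simple c N4 iN.
  have [l jl] := JT j jN tj.
  have : tight N (W l).1 (W l).2 j.
    apply: (absurd _ _ (WN l)) => j' jN' Tj'.
    have [l' jl'] := JT j' jN' (tF j' jN' Tj'); rewrite jl' WJ.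
    by apply/eqP => ll; apply: nTj; rewrite jl ll -jl'.
  by rewrite jl WJ eqxx.
exists (fun G => wedge_face N (T G)); last exact: mono.
split.
- by move=> G _; exact: wedge_face_face.
- move=> F' G'; rewrite !inE => fF' fG' e; apply/seteqP; split.
    by apply/(mono _ _ fF' fG'); rewrite e.
  by apply/(mono _ _ fG' fF'); rewrite e.
move=> E fE; have [E0|/nonemptyPn E0] := pselect (E !=set0); last first.
  exists set0; first exact: face_set0.
  rewrite E0; apply: contrapT => /eqP/set0P ne.
  have [c [i [iN]]] := wedge_face_vertex N7 (wedge_face_face N7 (T set0)) ne.
  move/(wedge_vertex_in N7 c _ iN) => H.
  have all j : (j < N)%N -> tight N c i j.
    move=> jN; apply: H => //; rewrite /T (dual_set0 bij anti).
    apply: sub_convex_hull.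
    have [i' _ <-] : range t (pt j) by apply/rangeE; right; exists j.
    by exists i'.
  (* The empty face lies on all facets, but no vertex lies on 1, 3 and 5: none of them is an end,
     and no two are consecutive. *)
  have h1 : tight N c i 1 by apply: all; lia.
  have h2 : tight N c i 3 by apply: all; lia.
  have h3 : tight N c i 5 by apply: all; lia.
  by move: h1 h2 h3; rewrite /tight; lia.
have [c [i [S [iN subS eE]]]] := wedge_faceE N7 fE E0.
have [D [fD D0 DS]] := sub_tight_face s0 smono rangeE iN subS.
have [G fG e] := dual_surj bij fD.
have GF : G `<=` F by apply/(anti fG fF); rewrite e fFE => _ ->.
exists G; first exact: face_of_face fG GF.
rewrite eE; apply/seteqP; split=> x [Qx H]; split=> // j jN Sj; apply: H => //.
  by rewrite /T e; apply/DS.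
by apply/(DS j jN); rewrite -e.
Qed.

End FacetInscribable.

Theorem theorem1p1 (R : realType) (k : nat) (hk : (8 <= k)%N) :
  (forall (n : nat) (P : set 'rV[R]_n), realizes_dual_cyclic 4 k P ->
     ~ exists F : set 'rV[R]_n, facet P F /\ inscribed F) /\
  (forall (n : nat) (P : set 'rV[R]_n), realizes_dual_cyclic 4 k P ->
     forall F : set 'rV[R]_n, facet P F -> inscribable F).
Proof.
split=> n P [polP dimP [t tinj [f bij anti]]].
  by move=> [F [facF inF]];
    exact: (facet_not_inscribed polP bij anti tinj hk dimP facF inF).
by move=> F facF; exact: (facet_inscribable polP bij anti tinj hk facF).
Qed.
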